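(* Let $C$ be a nonempty bounded closed and convex subset of a Banach space $X$ which has the super fixed point property for nonexpansive mappings (SFPP), and let $\mathcal{T}=\{T_t:t\in T\}$ be a commuting family of asymptotically nonexpansive in the intermediate sense mappings $T_t:C\to C$. Then there exists $x\in C$ such that $T_tx=x$ for every $t\in T$ (a common fixed point for $\mathcal{T}$).
   Context: $T$ is an arbitrary index set (possibly infinite); commuting means $T_sT_t=T_tT_s$ for all $s,t\in T$. A mapping $S:C\to C$ is asymptotically nonexpansive in the intermediate sense if $S$ is continuous and $\limsup_{n\to\infty}\sup_{x,y\in C}(\|S^nx-S^ny\|-\|x-y\|)\le 0$. A mapping $S:C\to C$ is nonexpansive if $\|Sx-Sy\|\le\|x-y\|$ for all $x,y\in C$. A Banach space $Y$ has the fixed point property (FPP) if every nonexpansive self-mapping of a nonempty bounded closed convex subset of $Y$ has a fixed point. A Banach space $Y$ is finitely representable in $X$ if for each $\varepsilon\in(0,1)$ and every finite-dimensional subspace $M\subset Y$ there exists a linear map $S:M\to X$ with $(1-\varepsilon)\|y\|\le\|Sy\|\le(1+\varepsilon)\|y\|$ for all $y\in M$. $X$ has the super fixed point property for nonexpansive mappings (SFPP) if every Banach space $Y$ finitely representable in $X$ has FPP. *)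

(* Defs.v *)
From mathcomp Require Import all_boot all_order all_algebra.
From mathcomp Require Import all_classical all_reals all_analysis.

Set Implicit Arguments.
Unset Strict Implicit.
Unset Printing Implicit Defensive.

Import Order.TTheory GRing.Theory Num.Theory.
Import numFieldNormedType.Exports.

Local Open Scope classical_set_scope.
Local Open Scope ring_scope.

(* Banach spaces are real, i.e. terms of [completeNormedModType R] for
   [R : realType]. A mapping C -> C is a total function f on the ambient space
   with [set_fun C C f]; all notions below only look at the values of f on C. *)

Definition nonexpansive (R : realType) (X : normedModType R) (C : set X)
    (f : X -> X) : Prop :=
  forall x y, C x -> C y -> `|f x - f y| <= `|x - y|.

(* The supremum and the limsup are taken in the extended reals. *)
Definition asymp_nonexpansive_intermediate (R : realType)
    (X : normedModType R) (C : set X) (f : X -> X) : Prop :=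
  {within C, continuous f} /\
  (limn_esup (fun n : nat => ereal_sup
     [set (`|iter n f x - iter n f y| - `|x - y|)%:E | x in C & y in C])
   <= 0)%E.

Definition fixed_point_property (R : realType)
    (Y : completeNormedModType R) : Prop :=
  forall (C : set Y) (f : Y -> Y),
    C !=set0 -> bounded_set C -> closed C ->
    convex_set (C : set (convex_lmodType Y)) ->
    set_fun C C f -> nonexpansive C f ->
    exists2 x, C x & f x = x.

(* The generators need not be linearly independent: the sets of this form are
   exactly the finite-dimensional linear subspaces, {0} included (n = 0). *)
Definition finite_dim_subspace (R : realType) (Y : normedModType R)
    (M : set Y) : Prop :=
  exists (n : nat) (e : 'I_n -> Y),
    M = [set y | exists a : 'I_n -> R, y = \sum_(i < n) a i *: e i].

Definition linear_on (R : realType) (Y X : normedModType R) (M : set Y)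
    (S : Y -> X) : Prop :=
  forall (a : R) (u v : Y), M u -> M v -> S (a *: u + v) = a *: S u + S v.

Definition finitely_representable (R : realType)
    (Y X : completeNormedModType R) : Prop :=
  forall (eps : R) (M : set Y),
    0 < eps -> eps < 1 -> finite_dim_subspace M ->
    exists S : Y -> X,
      linear_on M S /\
      forall y, M y -> (1 - eps) * `|y| <= `|S y| /\
                       `|S y| <= (1 + eps) * `|y|.

Definition super_fixed_point_property (R : realType)
    (X : completeNormedModType R) : Prop :=
  forall Y : completeNormedModType R,
    finitely_representable Y X -> fixed_point_property Y.

(* Main.v *)
Require Import Defs.
From HB Require Import structures.
From mathcomp Require Import all_boot all_order all_algebra.
From mathcomp Require Import all_classical all_reals all_analysis.
From mathcomp Require Import generic_quotient ring lra.

(* Write X_U for the ultrapower of X along an ultrafilter U; it is finitely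
   representable in X, so it has FPP, and even SFPP.

   Iterated limits along U define ultrapowers of X of every finite order, whose
   elements are functions of finitely many variables s 0, s 1, ...; the shift
   u |-> u o tail is isometric on them, and every point of the closure that is
   fixed by the shift is a constant, i.e. an element of X: if u depends on k
   variables and is close to its k-th shift, freeze the first k variables.
   Through FPP this has two consequences.
   - Applied to the convex hull of the variables x (s m), it shows that bounded
     families have "weak limits" along U: the limits of the Cesaro means. This
     is the compactness required by Bruck's argument, which provides
     nonexpansive retractions on the common fixed points of finite commuting
     families of nonexpansive maps.
   - Applied to u |-> r_(s 0) (u o tail), where r_J is the retraction attached
     to the finite subfamily J, it gives a common fixed point of an arbitrary
     commuting family of nonexpansive maps.

   For the commuting semigroup G generated by the T_t, consider in the
   ultrapower along an ultrafilter on nat the commuting nonexpansive maps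
   induced by the sequences (g_n) in G whose defect of nonexpansiveness tends
   to 0. If all g in G of small defect move x by at most r, the points that are
   eventually within r of the orbit of x under these maps form an invariant
   convex body that contains x and has radius at most 2r. A common fixed point
   in it yields x' in C with |x' - x| <= 3r that is moved by at most r/2.
   Iterating, one gets a limit z that is not moved asymptotically, so T_t^n z
   tends to z and T_t z = z. *)

Set Implicit Arguments.
Unset Strict Implicit.
Unset Printing Implicit Defensive.

Import Order.TTheory GRing.Theory Num.Theory.
Import numFieldNormedType.Exports.

Local Open Scope classical_set_scope.
Local Open Scope ring_scope.
Local Open Scope quotient_scope.

(** * Limits along ultrafilters *)

Lemma bounded_set_normP (R : realType) (X : normedModType R) (C : set X) :
  bounded_set C <-> exists M, forall x, C x -> `|x| <= M.
Proof.
split=> [[M [_ CM]]|[M CM]].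
  by exists (M + 1) => x /CM; apply; rewrite ltrDl.
exists M; split; first exact: num_real.
by move=> N MN x /CM /le_trans; apply; exact: ltW.
Qed.

Lemma closed_normP (R : realType) (X : normedModType R) (C : set X) :
  closed C <->
  forall x, (forall e, 0 < e -> exists2 y, C y & `|x - y| < e) -> C x.
Proof.
split=> [clC x Cx|clC x clCx].
  apply: clC => B /nbhs_ballP[e /= e0 eB].
  have [y Cy xy] := Cx _ e0; exists y; split => //; apply: eB.
  by rewrite -ball_normE.
apply: clC => e e0; have [y [Cy]] := clCx _ (nbhsx_ballx x e e0).
by rewrite -ball_normE /= => xy; exists y.
Qed.

Lemma convex_set_combP (R : realType) (X : normedModType R) (C : set X) :
  convex_set (C : set (convex_lmodType X)) <->
  forall x y t, C x -> C y -> 0 <= t -> t <= 1 -> C (t *: x + (1 - t) *: y).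
Proof.
split=> [cC x y t Cx Cy t0 t1|cC x y t /set_mem Cx /set_mem Cy].
  have t01 : (0 <= t <= 1)%R by rewrite t0 t1.
  have := cC x y (Itv01 t0 t1) (mem_set Cx) (mem_set Cy) => /set_mem.
  by [].
apply/mem_set.
exact: cC.
Qed.

Lemma filter_meetP (A : Type) (F : set_system A) {FF : ProperFilter F}
    (P Q : set A) : F P -> F Q -> exists2 a, P a & Q a.
Proof.
move=> FP FQ; have /filter_ex[a []] : F (P `&` Q) by exact: filterI.
by exists a.
Qed.

Section ulim.
Context (R : realType) (A : Type) (W : set_system A) {WU : UltraFilter W}.
Implicit Types f g : A -> R.

Definition ulim f : R := lim (f @ W).

Definition bddf f := exists M, forall a, `|f a| <= M.

(** Compactness of [[- M, M]] gives a cluster point [l]. For a neighbourhood of [l], the ultrafilter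
    contains its preimage or the complement, and clustering excludes the complement. *)
Lemma ultra_cvg f : bddf f -> exists l : R, f @ W --> l.
Proof.
move=> [M fM].
have FW : ProperFilter (f @ W) by apply: fmap_proper_filter.
have : (f @ W) `[- M, M]%classic.
  by apply: (@filterS _ W _ setT) => [a _|]; [rewrite /= in_itv /= -ler_norml|exact: filterT].
move=> /(segment_compact FW)[l [_ fl]]; exists l => B Bl /=.
have [//|WB] := in_ultra_setVsetC (f @^-1` B) WU.
by have [x []] := fl (~` B) B WB Bl.
Qed.

Lemma ulimP f : bddf f ->
  forall e, 0 < e -> W [set a | `|f a - ulim f| < e].
Proof.
move=> /ultra_cvg fcvg; have : cvg (f @ W) by apply/cvg_ex.
by move=> fl e e0; move/cvgrPdistC_lt : fl => /(_ _ e0).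
Qed.

Lemma ulim_le f c : bddf f ->
  (forall e, 0 < e -> W [set a | f a < c + e]) -> ulim f <= c.
Proof.
move=> bf fc; rewrite leNgt; apply/negP => cf.
have e0 : 0 < (ulim f - c) / 2 by rewrite divr_gt0// subr_gt0.
have [a /= fa h] := filter_meetP (fc _ e0) (ulimP bf e0).
by move: h; rewrite ltr_norml => /andP[]; lra.
Qed.

Lemma ulim_ge f c : bddf f ->
  (forall e, 0 < e -> W [set a | c - e < f a]) -> c <= ulim f.
Proof.
move=> bf fc; rewrite leNgt; apply/negP => cf.
have e0 : 0 < (c - ulim f) / 2 by rewrite divr_gt0// subr_gt0.
have [a /= fa h] := filter_meetP (fc _ e0) (ulimP bf e0).
by move: h; rewrite ltr_norml => /andP[]; lra.
Qed.

Lemma ulim_near_lt f c : bddf f -> ulim f < c -> W [set a | f a < c].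
Proof.
move=> bf fc; have e0 : 0 < c - ulim f by rewrite subr_gt0.
apply: filterS (ulimP bf e0) => a; rewrite /= ltr_norml => /andP[_]; lra.
Qed.

End ulim.

(** * Quotient of a seminormed space *)

(** Completeness is required only for sequences with geometrically small increments. This is enough
    for the quotient, because a Cauchy filter can be sampled along such a sequence. *)
Record seminorm (R : realType) (V : lmodType R) := Seminorm {
  sn :> V -> R;
  sn_le_add : forall u v, sn (u + v) <= sn u + sn v;
  snZ : forall a u, sn (a *: u) = `|a| * sn u;
  sn_complete : forall u : nat -> V,
    (forall n, sn (u n.+1 - u n) <= 2^-1 ^+ n) ->
    exists l, forall e, 0 < e -> exists N, forall n, (N <= n)%N ->
      sn (u n - l) <= e }.

Section seminorm_quotient.
Context (R : realType) (V : lmodType R) (p : seminorm V).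

Lemma sn0 : p 0 = 0.
Proof. by have := snZ p 0 0; rewrite scale0r normr0 mul0r. Qed.

Lemma snN u : p (- u) = p u.
Proof. by rewrite -scaleN1r snZ normrN normr1 mul1r. Qed.

Lemma sn_ge0 u : 0 <= p u.
Proof. by have := sn_le_add p u (- u); rewrite subrr sn0 snN; lra. Qed.

Definition sn_rel (u v : V) := p (u - v) == 0.

Lemma sn_rel_equiv : equiv_class_of sn_rel.
Proof.
split=> [u|u v|v u w]; rewrite /sn_rel.
- by rewrite subrr sn0.
- by rewrite -opprB snN.
- move=> /eqP uv /eqP vw; rewrite eq_le sn_ge0 andbT.
  by have := sn_le_add p (u - v) (v - w); rewrite subrKA uv vw addr0.
Qed.

Canonical sn_rel_canonical := EquivRelPack sn_rel_equiv.

Definition sn_quot := {eq_quot sn_rel}.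
HB.instance Definition _ := Choice.on sn_quot.

Definition sn_pi (u : V) : sn_quot := \pi_sn_quot u.

Lemma sn_piK x : sn_pi (repr x) = x. Proof. exact: reprK. Qed.

Lemma sn_pi_eq u v : sn_pi u = sn_pi v <-> p (u - v) = 0.
Proof. by split=> [/eqmodP/eqP|/eqP uv]; [|apply/eqmodP]. Qed.

Lemma sn_repr u : p (repr (sn_pi u) - u) = 0.
Proof. by apply/sn_pi_eq; rewrite sn_piK. Qed.

Definition sq_add (x y : sn_quot) := sn_pi (repr x + repr y).
Definition sq_opp (x : sn_quot) := sn_pi (- repr x).
Definition sq_scale a (x : sn_quot) := sn_pi (a *: repr x).
Definition sq_norm (x : sn_quot) := p (repr x).

Lemma sn_eq0_add u v : p u = 0 -> p v = 0 -> p (u + v) = 0.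
Proof.
move=> u0 v0; apply/le_anti; rewrite sn_ge0 andbT.
by have := sn_le_add p u v; rewrite u0 v0 addr0.
Qed.

Lemma sq_addE u v : sq_add (sn_pi u) (sn_pi v) = sn_pi (u + v).
Proof.
by apply/sn_pi_eq; rewrite opprD addrACA; apply: sn_eq0_add; exact: sn_repr.
Qed.

Lemma sq_oppE u : sq_opp (sn_pi u) = sn_pi (- u).
Proof. by apply/sn_pi_eq; rewrite -opprD snN sn_repr. Qed.

Lemma sq_scaleE a u : sq_scale a (sn_pi u) = sn_pi (a *: u).
Proof. by apply/sn_pi_eq; rewrite -scalerBr snZ sn_repr mulr0. Qed.

Lemma sq_normE u : sq_norm (sn_pi u) = p u.
Proof.
apply/le_anti/andP; split.
  have := sn_le_add p (repr (sn_pi u) - u) u.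
  by rewrite subrK sn_repr add0r.
have := sn_le_add p (- (repr (sn_pi u) - u)) (repr (sn_pi u)).
by rewrite opprB subrK -opprB snN sn_repr add0r.
Qed.

Lemma sq_ind (P : sn_quot -> Prop) : (forall u, P (sn_pi u)) -> forall x, P x.
Proof. by move=> Pu x; rewrite -(sn_piK x). Qed.

Lemma sq_addA : associative sq_add.
Proof.
by elim/sq_ind=> u; elim/sq_ind=> v; elim/sq_ind=> w; rewrite !sq_addE addrA.
Qed.

Lemma sq_addC : commutative sq_add.
Proof. by elim/sq_ind=> u; elim/sq_ind=> v; rewrite !sq_addE addrC. Qed.

Lemma sq_add0 : left_id (sn_pi 0) sq_add.
Proof. by elim/sq_ind=> u; rewrite !sq_addE add0r. Qed.

Lemma sq_addN : left_inverse (sn_pi 0) sq_opp sq_add.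
Proof. by elim/sq_ind=> u; rewrite sq_oppE !sq_addE addNr. Qed.

HB.instance Definition _ :=
  GRing.isZmodule.Build sn_quot sq_addA sq_addC sq_add0 sq_addN.

Lemma sn_piD u v : sn_pi (u + v) = sn_pi u + sn_pi v.
Proof. by rewrite -sq_addE. Qed.

Lemma sq_scaleA a b x : sq_scale a (sq_scale b x) = sq_scale (a * b) x.
Proof. by elim/sq_ind: x => u; rewrite !sq_scaleE scalerA. Qed.

Lemma sq_scale1 : left_id 1 sq_scale.
Proof. by elim/sq_ind=> u; rewrite !sq_scaleE scale1r. Qed.

Lemma sq_scaleDr : right_distributive sq_scale +%R.
Proof.
move=> a; elim/sq_ind=> u; elim/sq_ind=> v.
by rewrite -sn_piD !sq_scaleE -sn_piD scalerDr.
Qed.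

Lemma sq_scaleDl x : {morph sq_scale^~ x : a b / a + b}.
Proof.
elim/sq_ind: x => u a b /=.
by rewrite !sq_scaleE -sn_piD scalerDl.
Qed.

HB.instance Definition _ := GRing.Zmodule_isLmodule.Build R sn_quot
  sq_scaleA sq_scale1 sq_scaleDr sq_scaleDl.

Lemma sq_norm_le_add x y : sq_norm (x + y) <= sq_norm x + sq_norm y.
Proof.
elim/sq_ind: x => u; elim/sq_ind: y => v.
by rewrite -sn_piD !sq_normE sn_le_add.
Qed.

Lemma sq_normZ a x : sq_norm (a *: x) = `|a| * sq_norm x.
Proof.
by elim/sq_ind: x => u; rewrite [_ *: _]sq_scaleE !sq_normE snZ.
Qed.

Lemma sq_norm_eq0 x : sq_norm x = 0 -> x = 0.
Proof. by elim/sq_ind: x => u; rewrite sq_normE => u0; apply/sn_pi_eq; rewrite subr0. Qed.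

HB.instance Definition _ := @Lmodule_isNormed.Build R sn_quot sq_norm
  sq_norm_le_add sq_normZ sq_norm_eq0.

Lemma sn_piZ a u : sn_pi (a *: u) = a *: sn_pi u.
Proof. by rewrite -sq_scaleE. Qed.

Lemma norm_sn_pi u : `|sn_pi u| = p u.
Proof. exact: sq_normE. Qed.

Lemma sn_quot_complete (F : set_system sn_quot) :
  ProperFilter F -> cauchy F -> cvg F.
Proof.
move=> FF /cauchyP Fc.
have h0 n : 0 < 2^-1 ^+ n.+2 :> R by rewrite exprn_gt0.
(* Centres of balls that belong to [F]. The exponent [n.+2] in the radii keeps consecutive centres
   within [2^-1 ^+ n] of each other. *)
pose x n := xget 0 [set x : sn_quot | F (ball x (2^-1 ^+ n.+2))].
have Fx n : F (ball (x n) (2^-1 ^+ n.+2)).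
  have [y Fy] := Fc _ (h0 n).
  by have := @xgetPex _ 0 [set x : sn_quot | F (ball x (2^-1 ^+ n.+2))];
    apply; exists y.
have xx n m : `|x m - x n| < 2^-1 ^+ n.+2 + 2^-1 ^+ m.+2.
  have [y xy yx] := @filter_meetP _ F FF _ _ (Fx n) (Fx m).
  move: xy yx; rewrite -!ball_normE /= => xy yx.
  have := ler_normD (x m - y) (y - x n).
  by rewrite subrKA [`|y - _|]distrC; move: xy yx; lra.
have [|l hl] := @sn_complete _ _ p (fun n => repr (x n)).
  move=> n; rewrite -norm_sn_pi sn_piD -scaleN1r sn_piZ !sn_piK scaleN1r.
  apply/ltW/(lt_le_trans (xx _ _)).
  by rewrite !exprS; have := h0 n; rewrite !exprS; lra.
apply/cvg_ex; exists (sn_pi l); apply/cvgrPdist_lt => e e0 /=.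
have e20 : 0 < e / 2 by rewrite divr_gt0.
have [N hN] := hl _ e20.
have : (fun n => 2^-1 ^+ n : R) @ \oo --> (0 : R).
  by apply: cvg_expr; rewrite ger0_norm; lra.
move=> /cvgr0_norm_lt /(_ _ e20)[M _ hM].
pose n := maxn N M.
apply: filterS (Fx n) => y; rewrite -ball_normE /= => xy.
have : `|x n - sn_pi l| <= e / 2.
  rewrite -[x n]sn_piK -scaleN1r -sn_piZ -sn_piD scaleN1r norm_sn_pi.
  by apply: hN; rewrite leq_maxl.
have : `|2^-1 ^+ n.+2 : R| < e / 2.
  by apply: hM => /=; rewrite !leqW// leq_maxr.
rewrite gtr0_norm// => h1 h2.
have := ler_normD (sn_pi l - x n) (x n - y).
by rewrite subrKA [`|sn_pi l - x n|]distrC; move: xy h1 h2; lra.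
Qed.

HB.instance Definition _ := Uniform_isComplete.Build sn_quot sn_quot_complete.

End seminorm_quotient.

(** * Ultrapowers *)

Section bounded_functions.
Context (R : realType) (A : Type) (X : normedModType R).

Definition bounded_map (f : A -> X) := exists M, forall a, `|f a| <= M.

Definition bfun_pred : {pred A -> X} := fun f => `[< bounded_map f >].

Lemma bounded_map0 : bounded_map 0.
Proof. by exists 0 => a; rewrite /= normr0. Qed.

Lemma bounded_map_cst (x : X) : bounded_map (fun=> x).
Proof. by exists `|x|. Qed.

Lemma bounded_mapD f g :
  bounded_map f -> bounded_map g -> bounded_map (fun a => f a + g a).
Proof.
move=> [M fM] [N gN]; exists (M + N) => a.
by rewrite (le_trans (ler_normD _ _))// lerD.
Qed.

Lemma bounded_mapZ k f : bounded_map f -> bounded_map (fun a => k *: f a).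
Proof.
by move=> [M fM]; exists (`|k| * M) => a; rewrite normrZ ler_wpM2l.
Qed.

Lemma bounded_mapB f g :
  bounded_map f -> bounded_map g -> bounded_map (fun a => f a - g a).
Proof.
move=> bf bg; have := bounded_mapD bf (bounded_mapZ (-1) bg).
by under [X in bounded_map X]funext do rewrite scaleN1r.
Qed.

Fact bfun_submod_closed : submod_closed bfun_pred.
Proof.
split; first by apply/asboolP; exact: bounded_map0.
move=> k f g /asboolP bf /asboolP bg; apply/asboolP.
exact: bounded_mapD (bounded_mapZ k bf) bg.
Qed.

HB.instance Definition _ :=
  GRing.isSubmodClosed.Build R (A -> X) bfun_pred bfun_submod_closed.

Record bfun := BFun { bfun_val :> A -> X ; _ : bfun_val \in bfun_pred }.

HB.instance Definition _ := [isSub for bfun_val].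
HB.instance Definition _ := [Choice of bfun by <:].
HB.instance Definition _ := [SubChoice_isSubLmodule of bfun by <:].

End bounded_functions.

Lemma bddf_norm (R : realType) (A : Type) (X : normedModType R) (f : A -> X) :
  bounded_map f -> bddf (fun a => `|f a|).
Proof. by move=> [M fM]; exists M => a; rewrite normr_id. Qed.

Lemma geometric_cauchy (R : realType) (X : completeNormedModType R)
    (u : nat -> X) (c : R) :
  (forall n, `|u n.+1 - u n| <= c * 2^-1 ^+ n) ->
  exists l, forall n, `|u n - l| <= 2 * c * 2^-1 ^+ n.
Proof.
move=> uc.
have h0 n : 0 < 2^-1 ^+ n :> R by rewrite exprn_gt0.
have c0 : 0 <= c by have := le_trans (normr_ge0 _) (uc 0%N); rewrite expr0 mulr1.
(* The subtracted term makes the induction on [k] close, as in the exact sum of a finite geometric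
   series. *)
have uu n k : `|u (n + k)%N - u n| <= 2 * c * (2^-1 ^+ n - 2^-1 ^+ (n + k)).
  elim: k => [|k IH]; first by rewrite addn0 !subrr normr0 mulr0.
  have := ler_normD (u (n + k.+1)%N - u (n + k)%N) (u (n + k)%N - u n).
  rewrite subrKA addnS => /le_trans; apply.
  by apply: le_trans (lerD (uc _) IH) _; rewrite exprS; lra.
have uu' n k : `|u (n + k)%N - u n| <= 2 * c * 2^-1 ^+ n.
  apply: le_trans (uu n k) _; apply: ler_wpM2l; first by rewrite mulr_ge0.
  by rewrite lerBlDr lerDl ltW.
have h_cvg : (fun n => 2 * c * 2^-1 ^+ n) @ \oo --> (0 : R).
  rewrite -[X in _ --> X](mulr0 (2 * c)); apply: cvgMr.
  by apply: cvg_expr; rewrite ger0_norm; lra.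
have : cvg (u @ \oo).
  apply: cauchy_cvg; apply/cauchyP => e e0.
  move/cvgr0_norm_lt : h_cvg => /(_ _ e0)[N _ hN].
  exists (u N); exists N => // n /= Nn; rewrite -ball_normE /= distrC.
  rewrite -(subnKC Nn); apply: le_lt_trans (uu' _ _) _.
  by apply: le_lt_trans (ler_norm _) _; exact: (hN N (leqnn N)).
move=> /cvg_ex[l ul]; exists l => n; apply/ler_addgt0Pr => e e0.
move/cvgrPdist_lt : ul => /(_ _ e0)[N _ hN].
have := hN (n + N)%N (leq_addl _ _); rewrite distrC /= => h1.
have := ler_normD (u n - u (n + N)%N) (u (n + N)%N - l).
rewrite subrKA => /le_trans; apply; apply: lerD; last exact: ltW.
by rewrite distrC.
Qed.

Section ultrapower.
Context (R : realType) (A : Type) (X : completeNormedModType R).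
Context (W : set_system A) {WU : UltraFilter W}.

Definition usn (f : bfun A X) : R := ulim W (fun a => `|f a|).

Lemma bfunP (f : bfun A X) : bounded_map f.
Proof. by case: f => f bf; exact/asboolP. Qed.

Lemma usn_le (f : bfun A X) c : (forall e, 0 < e -> W [set a | `|f a| < c + e]) -> usn f <= c.
Proof. by apply: ulim_le; apply: bddf_norm; exact: bfunP. Qed.

Lemma usn_lt (f : bfun A X) e : 0 < e -> W [set a | `|f a| < usn f + e].
Proof.
move=> e0; apply: ulim_near_lt; first by apply: bddf_norm; exact: bfunP.
by rewrite ltrDl.
Qed.

Lemma usn_le_add u v : usn (u + v) <= usn u + usn v.
Proof.
apply: usn_le => e e0; have e20 : 0 < e / 2 by rewrite divr_gt0.
have [uW vW] := (usn_lt u e20, usn_lt v e20).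
apply: filterS (filterI uW vW) => a /= [ua va].
by apply: le_lt_trans (ler_normD _ _) _; lra.
Qed.

Lemma usnZ_le k u : usn (k *: u) <= `|k| * usn u.
Proof.
apply: usn_le => e e0.
have k0 : 0 < `|k| + 1 by rewrite ltr_wpDl.
have ek0 : 0 < e / (`|k| + 1) by rewrite divr_gt0.
apply: filterS (usn_lt u ek0) => a /= ua.
rewrite normrZ.
have : `|k| * `|u a| <= `|k| * (usn u + e / (`|k| + 1)).
  by rewrite ler_wpM2l// ltW.
move/le_lt_trans; apply; rewrite mulrDr ltrD2l mulrA ltr_pdivrMr//.
by rewrite mulrDr mulr1 mulrC ltrDl.
Qed.

Lemma usnZ k u : usn (k *: u) = `|k| * usn u.
Proof.
apply/le_anti; rewrite usnZ_le /=.
have [->|k0] := eqVneq k 0.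
  rewrite normr0 mul0r; apply: ulim_ge => [|e e0].
    by apply: bddf_norm; exact: bfunP.
  by apply: (@filterS _ W _ setT) filterT => a _ /=; rewrite scale0r normr0 sub0r oppr_lt0.
have := usnZ_le k^-1 (k *: u).
rewrite scalerA mulVf// scale1r normfV.
by rewrite ler_pdivlMl// normr_gt0.
Qed.

(** The increments are truncated pointwise at twice their expected size, so that the partial sums
    [v a] converge at every [a], with uniform rate. For each fixed [n] only finitely many
    truncations are involved, and [W]-almost everywhere they change nothing, so [v a n = u n a]
    there. *)
Lemma usn_complete (u : nat -> bfun A X) :
  (forall n, usn (u n.+1 - u n) <= 2^-1 ^+ n) ->
  exists l, forall e, 0 < e -> exists N, forall n, (N <= n)%N ->
    usn (u n - l) <= e.
Proof.
move=> uu.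
have h0 n : 0 < 2^-1 ^+ n :> R by rewrite exprn_gt0.
pose tr n (x : X) := if `|x| <= 2 * 2^-1 ^+ n then x else 0.
pose v a := fix v n := if n is k.+1 then v k + tr k (u k.+1 a - u k a) else u 0%N a.
have /choice[l hl] : forall a, exists x, forall n,
    `|v a n - x| <= 4 * 2^-1 ^+ n.
  move=> a; have [|l hl] := @geometric_cauchy _ X (v a) 2.
    move=> n /=; rewrite addrAC subrr add0r /tr.
    by case: ifP => // _; rewrite normr0 mulr_ge0// ltW.
  by exists l => n; apply: le_trans (hl n) _; lra.
have bl : bounded_map l.
  have [M uM] := bfunP (u 0%N); exists (M + 4) => a.
  have := hl a 0%N; rewrite expr0 mulr1 /= => h1.
  have := ler_normB (u 0%N a) (u 0%N a - l a).
  by rewrite opprB addrC subrK; have := uM a; lra.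
have bl' : l \in @bfun_pred R A X by apply/asboolP.
exists (BFun bl') => e e0.
have Wv n : W [set a | v a n = u n a].
  elim: n => [|n IH]; first by apply: (@filterS _ W _ setT) filterT.
  have := usn_lt (u n.+1 - u n) (h0 n).
  move=> /(filterI IH); apply: filterS => a /= [-> lt].
  rewrite /tr ifT; first by rewrite addrC subrK.
  by apply/ltW/(lt_le_trans lt); have := uu n; lra.
have : (fun n => 2^-1 ^+ n) @ \oo --> (0 : R).
  by apply: cvg_expr; rewrite ger0_norm; lra.
have e40 : 0 < e / 4 by rewrite divr_gt0.
move=> /cvgr0_norm_lt /(_ _ e40)[N _ hN]; exists N => n Nn.
apply: usn_le => d d0; apply: filterS (Wv n) => a /= va.
have := hl a n; rewrite va => /le_lt_trans; apply.
have := hN n Nn; rewrite /= gtr0_norm//; lra.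
Qed.

Definition useminorm : seminorm (bfun A X) :=
  Seminorm usn_le_add usnZ usn_complete.

Lemma insubd_bfun (f : A -> X) : bounded_map f -> insubd (0 : bfun A X) f = f :> (A -> X).
Proof. by move=> bf; rewrite /insubd insubT//; apply/asboolP. Qed.

(** The ultrapower is presented through a map [pi] on functions, so that later arguments work with
    representatives and pointwise estimates. The last two fields together say that the norm of
    [pi f] is the limit of the norms of [f a] along [W]. *)
Record is_ultrapower (Y : completeNormedModType R) (pi : (A -> X) -> Y) : Prop :=
  IsUltrapower {
    upiP : forall k f g, bounded_map f -> bounded_map g ->
      pi (fun a => k *: f a + g a) = k *: pi f + pi g ;
    upi_surj : forall y, exists2 f, bounded_map f & pi f = y ;
    norm_upi_le : forall f c, bounded_map f ->
      (forall e, 0 < e -> W [set a | `|f a| < c + e]) -> `|pi f| <= c ;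
    near_norm_upi : forall f c, bounded_map f -> `|pi f| < c ->
      W [set a | `|f a| < c] }.

Lemma ultrapower_exists :
  exists (Y : completeNormedModType R) (pi : (A -> X) -> Y), is_ultrapower pi.
Proof.
(* Unbounded functions get the default class of 0. *)
exists (sn_quot useminorm), (fun f => sn_pi useminorm (insubd 0 f)).
have normE f : bounded_map f ->
    `|sn_pi useminorm (insubd 0 f)| = ulim W (fun a => `|f a|).
  move=> bf; rewrite norm_sn_pi /= /usn; congr ulim; apply/funext => a.
  by rewrite insubd_bfun.
split.
- move=> k f g bf bg; rewrite -sn_piZ -sn_piD; congr sn_pi; apply/val_inj.
  apply/funext => a; rewrite [RHS]/= /GRing.add /GRing.scale /=.
  rewrite !insubd_bfun//; exact: bounded_mapD (bounded_mapZ k bf) bg.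
- move=> y; exists (repr y : bfun A X); first exact: bfunP.
  rewrite -[RHS]sn_piK; congr sn_pi; apply/val_inj.
  by apply: insubd_bfun; exact: bfunP.
- by move=> f c bf fc; rewrite normE//; apply: ulim_le => //; exact: bddf_norm.
- by move=> f c bf; rewrite normE// => /ulim_near_lt; apply; exact: bddf_norm.
Qed.

End ultrapower.

Section ultrapower_norm.
Context (R : realType) (A : Type) (X Y : completeNormedModType R).
Context (W : set_system A) {WU : UltraFilter W}.
Context (pi : (A -> X) -> Y) (piW : is_ultrapower W pi).
Implicit Types f g : A -> X.

Lemma upi0 : pi (fun=> 0 : X) = 0.
Proof.
have b0 := @bounded_map_cst R A X 0.
have -> : (fun=> 0 : X) = (fun _ : A => (-1) *: (0 : X) + 0).
  by apply/funext => a; rewrite scaler0 addr0.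
by rewrite (upiP piW)// scaleN1r addNr.
Qed.

Lemma upiZ k f : bounded_map f -> pi (fun a => k *: f a) = k *: pi f.
Proof.
move=> bf; have b0 := @bounded_map_cst R A X 0.
have -> : (fun a => k *: f a) = (fun a => k *: f a + 0).
  by apply/funext => a; rewrite addr0.
by rewrite (upiP piW)// upi0 addr0.
Qed.

Lemma upiB f g : bounded_map f -> bounded_map g ->
  pi (fun a => f a - g a) = pi f - pi g.
Proof.
move=> bf bg; rewrite -[- pi g]scaleN1r addrC -(upiP piW)//.
by congr pi; apply/funext => a; rewrite scaleN1r addrC.
Qed.

Lemma upi_sum (n : nat) (c : 'I_n -> R) (f : 'I_n -> A -> X) :
  (forall i, bounded_map (f i)) ->
  bounded_map (fun a => \sum_(i < n) c i *: f i a) /\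
  pi (fun a => \sum_(i < n) c i *: f i a) = \sum_(i < n) c i *: pi (f i).
Proof.
elim: n c f => [|n IH] c f bf.
  split; first by exists 0 => a; rewrite big_ord0 normr0.
  by rewrite big_ord0 -upi0; congr pi; apply/funext => a; rewrite big_ord0.
have [b1 b2] := IH (fun i => c (lift ord0 i)) (fun i => f (lift ord0 i))
  (fun i => bf (lift ord0 i)).
under [X in bounded_map X /\ pi X = _]funext do rewrite big_ord_recl.
rewrite big_ord_recl -b2 (upiP piW)//; split => //.
exact: bounded_mapD (bounded_mapZ _ (bf ord0)) b1.
Qed.

Lemma near_norm_upiP f e : bounded_map f -> 0 < e ->
  W [set a | `| `|f a| - `|pi f| | < e].
Proof.
move=> bf e0.
have h1 : W [set a | `|f a| < `|pi f| + e].
  by apply: (near_norm_upi piW) => //; rewrite ltrDl.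
(* Otherwise [W]-almost all values would have norm at most [|pi f| - e], and [norm_upi_le] would
   give [|pi f| <= |pi f| - e]. *)
have h2 : W [set a | `|pi f| - e < `|f a|].
  have [//|h] := in_ultra_setVsetC [set a | `|pi f| - e < `|f a|] WU.
  exfalso; have : `|pi f| <= `|pi f| - e.
    apply: (norm_upi_le piW) => // d d0; apply: filterS h => a /= /negP.
    by rewrite -leNgt => /le_lt_trans; apply; rewrite ltrDl.
  by rewrite leNgt gtrBl e0.
apply: filterS (filterI h1 h2) => a [/=].
by rewrite ltr_distl => ? ?; apply/andP.
Qed.

End ultrapower_norm.

(** * Finite representability of ultrapowers *)

Definition span_set (R : realType) (Y : normedModType R) n (e : 'I_n -> Y) :=
  [set y | exists a : 'I_n -> R, y = \sum_(i < n) a i *: e i].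

Lemma independent_generators (R : realType) (Y : normedModType R) n
    (e : 'I_n -> Y) : exists m (e' : 'I_m -> Y), span_set e' = span_set e /\
  forall a : 'I_m -> R, \sum_(i < m) a i *: e' i = 0 -> forall i, a i = 0.
Proof.
elim: n e => [|n IH] e; first by exists 0%N, e; split => // a _ [].
have [ind|] := pselect (forall a : 'I_n.+1 -> R,
  \sum_(i < n.+1) a i *: e i = 0 -> forall i, a i = 0).
  by exists n.+1, e.
move=> /existsNP[a /not_implyP[ae0 /existsNP[k /eqP ak0]]].
have [m [e' [e'e ind]]] := IH (e \o lift k).
exists m, e'; split => //; rewrite e'e; apply/seteqP; split => y /=.
  move=> [b ->].
  exists (fun i => if unlift k i is Some j then b j else 0).
  rewrite (bigD1_ord k)//= unlift_none scale0r add0r.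
  by apply: eq_bigr => i _; rewrite liftK.
move=> [b ->].
(* Coefficients obtained by substituting for [e k] the combination of the other generators given by
   the relation [a]. *)
exists (fun j => b (lift k j) - b k / a k * a (lift k j)).
have ek : e k = - \sum_(j < n) (a (lift k j) / a k) *: e (lift k j).
  move: ae0; rewrite (bigD1_ord k)//= => /eqP; rewrite addr_eq0 => /eqP ae.
  have := congr1 ( *:%R (a k)^-1) ae; rewrite scalerA mulVf// scale1r => ->.
  rewrite scalerN scaler_sumr; congr (- _); apply: eq_bigr => j _.
  by rewrite scalerA mulrC.
rewrite (bigD1_ord k)//= ek scalerN scaler_sumr -sumrN -big_split /=.
apply: eq_bigr => j _; rewrite scalerA -scaleNr -scalerDl; congr (_ *: _).
by rewrite addrC; congr (_ - _); rewrite mulrCA mulrC.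
Qed.

(** Numerical end of the next proof: [n0] and [l0] are the norms of the limit combination and of its
    image, [n] and [l] those of a nearby bad combination. A relative deviation above [eps] at the
    latter cannot survive the perturbation. *)
Lemma perturbed_deviation_absurd (R : realType) (eps n n0 l l0 c d : R) :
  0 < eps -> 0 < n0 -> c + d = eps * n0 / 4 -> c <= n0 / 4 ->
  `|l0 - n0| < d -> `|n - n0| <= c -> `|l - l0| <= c ->
  eps * n < `|l - n| -> False.
Proof.
move=> e0 n00 cd c4 h1 h2 h3; apply/negP; rewrite -leNgt.
move: h1 h2 h3; rewrite ltr_norml !ler_norml.
move=> /andP[h1 h1'] /andP[h2 h2'] /andP[h3 h3'].
have : eps * (n0 * 3 / 4) <= eps * n by rewrite ler_pM2l//; lra.
by move=> h4; apply/andP; split; lra.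
Qed.

(** The embedding sends a combination of the [e i] to the same combination of the values [f i s] of
    representatives, for one well-chosen [s]. If almost every [s] failed, normalized bad coefficient
    vectors would converge along [W] to a nonzero vector [bb]. Near [bb] the norms of [L s] tend to
    [N bb > 0], which contradicts badness. *)
Lemma finitely_representable_ultrapower (R : realType) (A : Type)
    (X Y : completeNormedModType R) (W : set_system A) (pi : (A -> X) -> Y) :
  UltraFilter W -> is_ultrapower W pi -> finitely_representable Y X.
Proof.
move=> WU piW eps M eps0 eps1 [n0 [e0 Me0]].
have [n [e [span_e ind_e]]] := independent_generators e0.
have {}Me : M = span_set e by rewrite span_e Me0.
have /choice[f fP] : forall i, exists f, bounded_map f /\ pi f = e i.
  by move=> i; have [f bf fe] := upi_surj piW (e i); exists f.
have bf i := (fP i).1; have fe i := (fP i).2.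
have /choice[B fB] : forall i, exists B, forall a, `|f i a| <= B by exact: bf.
pose L s (a : 'I_n -> R) := \sum_(i < n) a i *: f i s.
pose N (a : 'I_n -> R) := `|\sum_(i < n) a i *: e i|.
have eB i : `|e i| <= B i.
  rewrite -fe; apply: (norm_upi_le piW) => // d d0.
  by apply: (@filterS _ W _ setT) filterT => s _ /=; rewrite ltr_pwDr.
have B0 i : 0 <= B i by apply: le_trans (eB i).
pose BS := \sum_(i < n) B i.
have BS0 : 0 <= BS by apply: sumr_ge0.
have diffB (Z : normedModType R) (g : 'I_n -> Z) (a b : 'I_n -> R) d :
    (forall i, `|g i| <= B i) -> (forall i, `|a i - b i| < d) ->
    `| `|\sum_(i < n) a i *: g i| - `|\sum_(i < n) b i *: g i| | <= d * BS.
  move=> gB abd; apply: le_trans (ler_dist_dist _ _) _.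
  rewrite -sumrB mulr_sumr; apply: le_trans (ler_norm_sum _ _ _) _.
  apply: ler_sum => i _; rewrite -scalerBl normrZ.
  by apply: ler_pM => //; exact: ltW.
suff : W [set s | forall a, (1 - eps) * N a <= `|L s a| <= (1 + eps) * N a].
  move=> /filter_ex[s /= hs].
  have /choice[c cP] : forall y, exists c : 'I_n -> R,
      M y -> y = \sum_(i < n) c i *: e i.
    move=> y; have [My|nMy] := pselect (M y); last by exists (fun=> 0).
    by move: (My); rewrite Me => -[c ->]; exists c.
  exists (fun y => L s (c y)); split; last first.
    move=> y My; have /andP[h1 h2] := hs (c y).
    by rewrite {1}(cP y My) [X in _ /\ _ <= _ * `|X|](cP y My).
  move=> a u v Mu Mv.
  have Mauv : M (a *: u + v).
    move: Mu Mv; rewrite Me => -[b ->] [b' ->].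
    exists (fun i => a * b i + b' i); rewrite scaler_sumr -big_split /=.
    by apply: eq_bigr => i _; rewrite scalerDl scalerA.
  rewrite /L scaler_sumr -big_split /=; apply: eq_bigr => i _.
  rewrite scalerA -scalerDl; congr (_ *: _); apply/eqP; rewrite -subr_eq0.
  apply/eqP; move: i; apply: ind_e.
  transitivity (\sum_(i < n) c (a *: u + v) i *: e i -
    (a *: \sum_(i < n) c u i *: e i + \sum_(i < n) c v i *: e i)).
    rewrite scaler_sumr -big_split -sumrB /=; apply: eq_bigr => i _.
    by rewrite scalerBl scalerDl scalerA.
  by rewrite -!cP// subrr.
have [//|bad] := in_ultra_setVsetC [set s | forall a,
  (1 - eps) * N a <= `|L s a| <= (1 + eps) * N a] WU.
(* For a bad [s], [b s] is a violating vector scaled to have l1-norm 1; for a good [s] it is 0. Its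
   coordinates are thus bounded by 1 everywhere and have limits along [W]. *)
have /choice[b bP] : forall s, exists b : 'I_n -> R,
    (forall i, `|b i| <= 1) /\
    (~ (forall a, (1 - eps) * N a <= `|L s a| <= (1 + eps) * N a) ->
     \sum_(i < n) `|b i| = 1 /\ eps * N b < `| `|L s b| - N b |).
  move=> s; have [h|] := pselect (forall a,
      (1 - eps) * N a <= `|L s a| <= (1 + eps) * N a).
    by exists (fun=> 0); split => // i; rewrite normr0.
  move=> nh; move: (nh) => /existsNP[a aP].
  pose S := \sum_(i < n) `|a i|.
  have S0 : 0 < S.
    rewrite lt_neqAle sumr_ge0// andbT; apply/eqP => S0; apply: aP.
    have a0 i : a i = 0.
      apply/eqP; rewrite -normr_eq0; apply/eqP.
      by apply: (psumr_eq0P (P := xpredT) (F := fun i => `|a i|)).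
    have z (Z : lmodType R) (g : 'I_n -> Z) : \sum_(i < n) a i *: g i = 0.
      by apply: big1 => i _; rewrite a0 scale0r.
    by rewrite /N /L !z !normr0 !mulr0 lexx.
  have SV0 : 0 < S^-1 by rewrite invr_gt0.
  exists (fun i => S^-1 * a i); split => [i|_].
    rewrite normrM gtr0_norm// ler_pdivrMl// mulr1 /S (bigD1 i)//=.
    by rewrite lerDl sumr_ge0.
  split.
    under eq_bigr do rewrite normrM gtr0_norm//.
    by rewrite -mulr_sumr mulVf// gt_eqF.
  have sc (Z : lmodType R) (g : 'I_n -> Z) :
      \sum_(i < n) (S^-1 * a i) *: g i = S^-1 *: \sum_(i < n) a i *: g i.
    by rewrite scaler_sumr; apply: eq_bigr => i _; rewrite scalerA.
  rewrite /N /L !sc !normrZ gtr0_norm// -mulrBr normrM gtr0_norm//.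
  rewrite mulrCA ltr_pM2l// -/(L s a) -/(N a) ltNge ler_norml.
  apply/negP => /andP[h1 h2]; apply: aP; apply/andP.
  by move: h1 h2; split; lra.
have b1 i : bddf (fun s => b s i) by exists 1 => s; exact: (bP s).1.
pose bb i := ulim W (fun s => b s i).
have near_b d : 0 < d -> W [set s | forall i, `|b s i - bb i| < d].
  move=> d0.
  by apply: filter_forall => i; exact: ulimP.
(* If all limits vanished, some bad [s] would have its [n] coordinates below [1 / (n + 1)], and the
   l1-norm could not be 1. *)
have bb0 : exists i, bb i != 0.
  apply: contrapT => /forallNP bb0.
  have n1 : 0 < (n%:R + 1)^-1 :> R by rewrite invr_gt0 ltr_pwDr.
  have [s hs [S1 _]] : exists2 s, (forall i, `|b s i - bb i| < (n%:R + 1)^-1)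
    & \sum_(i < n) `|b s i| = 1 /\ eps * N (b s) < `| `|L s (b s)| - N (b s) |.
    have [s h1 h2] := filter_meetP (near_b _ n1) bad.
    by exists s => //; exact: (bP s).2.
  have : \sum_(i < n) `|b s i| <= \sum_(i < n) (n%:R + 1)^-1.
    apply: ler_sum => i _; apply: ltW; have := hs i.
    by have /negP := bb0 i; rewrite negbK => /eqP ->; rewrite subr0.
  rewrite S1 sumr_const card_ord -[X in _ <= X]mulr_natl ler_pdivlMr ?ltr_pwDr//.
  by rewrite mul1r; lra.
have N0 : 0 < N bb.
  rewrite normr_gt0; apply/eqP => /ind_e bb00; have [i] := bb0.
  by rewrite bb00 eqxx.
(* Chosen so that [d * BS + d = eps * N bb / 4]; the [+ 1] keeps the denominator positive when [BS]
   is 0. *)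
pose d := eps * N bb / (4 * (BS + 1)).
have d0 : 0 < d by rewrite divr_gt0// mulr_gt0// ltr_pwDr.
have dBS : d * BS + d = eps * N bb / 4.
  by rewrite /d; field; rewrite gt_eqF// ltr_pwDr.
have [bL upiL] := upi_sum piW bb bf.
have eN : `|pi (fun a => \sum_(i < n) bb i *: f i a)| = N bb.
  by rewrite upiL; congr `|_|; apply: eq_bigr => i _; rewrite fe.
have nL : W [set s | `| `|L s bb| - N bb| < d].
  by rewrite -eN; exact: (near_norm_upiP piW).
have [s [/= h1 h2] h3] := filter_meetP (filterI (near_b _ d0) nL) bad.
have [_] := (bP s).2 h3.
have := diffB _ (fun i => f i s) (b s) bb d (fun i => fB i s) h1.
have := diffB _ e (b s) bb d eB h1.
rewrite -/(N (b s)) -/(N bb) -/(L s (b s)).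
move: h2; rewrite -/(L s bb) => h2 h4 h5 h6; exfalso.
have h7 : d * BS <= N bb / 4.
  apply: (@le_trans _ _ (eps * N bb / 4)); first by rewrite -dBS lerDl ltW.
  by rewrite ler_pM2r// ger_pMl// ltW.
exact: perturbed_deviation_absurd eps0 N0 dBS h7 h2 h4 h5 h6.
Qed.

Lemma finitely_representable_refl (R : realType) (X : completeNormedModType R) :
  finitely_representable X X.
Proof.
move=> eps M e0 e1 _; exists id; split=> [a u v _ _ //|y _].
have := normr_ge0 y; split.
  by rewrite ler_piMl// gerBl ltW.
by rewrite ler_peMl// lerDl ltW.
Qed.

Lemma linear_on_span (R : realType) (Y X : normedModType R) n (e : 'I_n -> Y)
    (S : Y -> X) (a : 'I_n -> R) : linear_on (span_set e) S ->
  S (\sum_(i < n) a i *: e i) = \sum_(i < n) a i *: S (e i).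
Proof.
move=> linS.
have M0 : span_set e 0.
  by exists (fun=> 0); rewrite big1// => i _; rewrite scale0r.
have Me i : span_set e (e i).
  exists (fun j => (j == i)%:R); rewrite (bigD1 i)//= eqxx scale1r big1 ?addr0//.
  by move=> j /negbTE ->; rewrite scale0r.
have MD k u v : span_set e u -> span_set e v -> span_set e (k *: u + v).
  move=> [b ->] [c ->]; exists (fun i => k * b i + c i).
  rewrite scaler_sumr -big_split /=; apply: eq_bigr => i _.
  by rewrite scalerDl scalerA.
have S0 : S 0 = 0.
  by have := linS (-1) 0 0 M0 M0; rewrite scaler0 addr0 scaleN1r addNr.
suff [_ ->] : span_set e (\sum_(i < n) a i *: e i) /\
    S (\sum_(i < n) a i *: e i) = \sum_(i < n) a i *: S (e i) by [].
apply: (big_rec2 (fun u v => span_set e u /\ S u = v)) => // i u v _ [Mu <-].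
by split; [exact: MD|exact: linS].
Qed.

Lemma finitely_representable_trans (R : realType)
    (Z Y X : completeNormedModType R) :
  finitely_representable Z Y -> finitely_representable Y X ->
  finitely_representable Z X.
Proof.
move=> ZY YX eps M eps0 eps1 [n [e Me]].
have {}Me : M = span_set e := Me.
(* For [eps < 1], the squares of [1 - eps / 3] and [1 + eps / 3] lie between [1 - eps] and
   [1 + eps]. *)
have e3 : 0 < eps / 3 by rewrite divr_gt0.
have e31 : eps / 3 < 1 by lra.
have Mfin : finite_dim_subspace M by exists n, e.
have [S [linS Sb]] := ZY _ _ e3 e31 Mfin.
have Nfin : finite_dim_subspace (span_set (S \o e)) by exists n, (S \o e).
have [S' [linS' S'b]] := YX _ _ e3 e31 Nfin.
have SM y : M y -> span_set (S \o e) (S y).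
  by rewrite Me => -[a ->]; exists a; apply: linear_on_span; rewrite -Me.
exists (S' \o S); split.
  by move=> a u v Mu Mv /=; rewrite linS// linS'//; exact: SM.
move=> y My /=; have [h1 h2] := Sb y My; have [h3 h4] := S'b _ (SM _ My).
have y0 := normr_ge0 y; split.
  apply: le_trans h3; apply: (@le_trans _ _ ((1 - eps / 3) * ((1 - eps / 3) * `|y|))).
    by rewrite mulrA ler_wpM2r//; nra.
  by rewrite ler_pM2l//; lra.
apply: (le_trans h4); apply: (@le_trans _ _ ((1 + eps / 3) * ((1 + eps / 3) * `|y|))).
  by rewrite ler_pM2l//; lra.
by rewrite mulrA ler_wpM2r//; nra.
Qed.

Lemma super_fixed_point_property_representable (R : realType)
    (X Y : completeNormedModType R) : finitely_representable Y X ->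
  super_fixed_point_property X -> super_fixed_point_property Y.
Proof. by move=> YX SX Z ZY; apply: SX; exact: finitely_representable_trans YX. Qed.

(** * Fixed points of nonexpansive maps in ultrapowers *)

Lemma exists_half_expr_lt (R : realType) (e : R) :
  0 < e -> exists n, 2^-1 ^+ n < e.
Proof.
move=> e0; have : (fun n => 2^-1 ^+ n) @ \oo --> (0 : R).
  by apply: cvg_expr; rewrite ger0_norm; lra.
move=> /cvgr0_norm_lt /(_ _ e0)[n _ /(_ n (leqnn n)) /=].
by rewrite gtr0_norm ?exprn_gt0// => h; exists n.
Qed.

(** FPP of the ultrapower is applied to the closure [K] of the image of [Q], to which [f] extends
    because it is nonexpansive modulo [W]. The fixed point is returned as a function [y] with
    approximants in [Q], so that [Q] may consist of functions of finitely many variables, although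
    [y] need not be one. *)
Lemma ultrapower_fixed_point (R : realType) (X : completeNormedModType R)
    (A : Type) (W : set_system A) (WU : UltraFilter W)
    (Q : set (A -> X)) (f : (A -> X) -> A -> X) (B : R) :
  super_fixed_point_property X ->
  Q !=set0 -> (forall u, Q u -> forall a, `|u a| <= B) ->
  (forall u v t, Q u -> Q v -> 0 <= t -> t <= 1 ->
    Q (fun a => t *: u a + (1 - t) *: v a)) ->
  (forall u, Q u -> Q (f u)) ->
  (forall u v c, Q u -> Q v -> W [set a | `|u a - v a| < c] ->
    W [set a | `|f u a - f v a| < c]) ->
  exists2 y, bounded_map y & forall e, 0 < e -> exists u, [/\ Q u,
    W [set a | `|u a - y a| < e] & W [set a | `|f u a - y a| < e]].
Proof.
move=> SX [u0 Qu0] QB Qconv fQ fne.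
have bQ u : Q u -> bounded_map u by move=> Qu; exists B; exact: QB.
have [Y [pi piW]] := @ultrapower_exists R A X W WU.
have pifr := finitely_representable_ultrapower WU piW.
pose K : set Y := [set y | forall e, 0 < e -> exists2 u, Q u & `|pi u - y| < e].
have fne' u v : Q u -> Q v -> `|pi (f u) - pi (f v)| <= `|pi u - pi v|.
  move=> Qu Qv; have [Qfu Qfv] := (fQ _ Qu, fQ _ Qv).
  rewrite -!(upiB piW); try exact: bQ.
  apply: (norm_upi_le piW) => [|e e0]; first by apply: bounded_mapB; exact: bQ.
  apply: fne => //; apply: (near_norm_upi piW); last by rewrite ltrDl.
  by apply: bounded_mapB; exact: bQ.
(* [G] is the closure of the graph of the map induced by [f]. Each [y] in [K] has a partner, because
   [f] turns a fast Cauchy sequence of approximants into a Cauchy sequence. *)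
pose G (y z : Y) := forall e, 0 < e ->
  exists u, [/\ Q u, `|pi u - y| < e & `|pi (f u) - z| < e].
have /choice[F GF] : forall y, exists z, K y -> G y z.
  move=> y; have [Ky|] := pselect (K y); last by exists 0.
  have h0 n : 0 < 2^-1 ^+ n.+2 :> R by rewrite exprn_gt0.
  have /choice[u uP] : forall n, exists u, Q u /\ `|pi u - y| < 2^-1 ^+ n.+2.
    by move=> n; have [u] := Ky _ (h0 n); exists u.
  have [|z hz] := @geometric_cauchy _ Y (fun n => pi (f (u n))) 1.
    move=> n; have [[Qn hn] [Qn1 hn1]] := (uP n, uP n.+1).
    apply: (le_trans (fne' _ _ Qn1 Qn)).
    have := ler_normB (pi (u n.+1) - y) (pi (u n) - y).
    rewrite opprB subrKA => /le_trans; apply.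
    move: hn hn1 (h0 n); rewrite !exprS; lra.
  exists z => _ e e0; have [n hn] := exists_half_expr_lt e0.
  exists (u n.+2); have [Qn yn] := uP n.+2; split => //.
    apply: lt_trans yn _; move: hn (h0 n); rewrite !exprS; lra.
  apply: le_lt_trans (hz _) _; move: hn (h0 n); rewrite !exprS; lra.
have [||||||y Ky Fy] := SX _ pifr K F.
- by exists (pi u0) => e e0; exists u0 => //; rewrite subrr normr0.
- apply/bounded_set_normP; exists (B + 1) => y /(_ _ ltr01)[u Qu uy].
  have : `|pi u| <= B.
    apply: (norm_upi_le piW) => [|e e0]; first exact: bQ.
    apply: (@filterS _ W _ setT) filterT => a _ /=.
    by apply: le_lt_trans (QB _ Qu a) _; rewrite ltrDl.
  have := ler_normB (pi u) (pi u - y); rewrite opprB addrC subrK; lra.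
- apply/closed_normP => y Ky e e0; have e20 : 0 < e / 2 by rewrite divr_gt0.
  have [z Kz yz] := Ky _ e20; have [u Qu uz] := Kz _ e20.
  exists u => //; have := ler_normB (pi u - z) (y - z).
  by rewrite opprB subrKA; lra.
- apply/convex_set_combP => y z t Ky Kz t0 t1 e e0.
  have [u Qu uy] := Ky _ e0; have [v Qv vz] := Kz _ e0.
  exists (fun a => t *: u a + (1 - t) *: v a); first exact: Qconv.
  rewrite (upiP piW); [|exact: bQ|by apply: bounded_mapZ; exact: bQ].
  rewrite (upiZ piW); last exact: bQ.
  rewrite opprD addrACA -!scalerBr.
  apply: le_lt_trans (ler_normD _ _) _; rewrite !normrZ !ger0_norm ?subr_ge0//.
  have [->|t0'] := eqVneq t 0; first by rewrite mul0r add0r subr0 mul1r.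
  have {}t0' : 0 < t by rewrite lt_neqAle eq_sym t0'.
  have h1 : t * `|pi u - y| < t * e by rewrite ltr_pM2l.
  have h2 : (1 - t) * `|pi v - z| <= (1 - t) * e.
    by rewrite ler_wpM2l ?subr_ge0// ltW.
  lra.
- move=> y Ky e e0; have [u [Qu _ fu]] := GF _ Ky _ e0.
  by exists (f u) => //; exact: fQ.
- move=> y z Ky Kz; apply/ler_addgt0Pr => e e0.
  have e40 : 0 < e / 4 by rewrite divr_gt0.
  have [u [Qu uy fu]] := GF _ Ky _ e40; have [v [Qv vz fv]] := GF _ Kz _ e40.
  have := fne' _ _ Qu Qv.
  have h1 : `|F y - F z| <= `|pi (f u) - F y| +
      `|pi (f u) - pi (f v)| + `|pi (f v) - F z|.
    have := ler_distD (pi (f u)) (F y) (F z).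
    have := ler_distD (pi (f v)) (pi (f u)) (F z).
    by rewrite [`|F y - pi _|]distrC; lra.
  have h2 : `|pi u - pi v| <= `|pi u - y| + `|y - z| + `|pi v - z|.
    have := ler_distD y (pi u) (pi v); have := ler_distD z y (pi v).
    by rewrite [`|z - pi _|]distrC; lra.
  move: uy fu vz fv; lra.
have [w bw wy] := upi_surj piW y; exists w => // e e0.
have [u [Qu uy fu]] := GF _ Ky _ e0; exists u; split => //.
  apply: (near_norm_upi piW); first by apply: bounded_mapB => //; exact: bQ.
  by rewrite (upiB piW)//; [rewrite wy|exact: bQ].
apply: (near_norm_upi piW); first by apply: bounded_mapB => //; exact: bQ (fQ _ Qu).
by rewrite (upiB piW)//; [rewrite wy -Fy|exact: bQ (fQ _ Qu)].
Qed.

(** * Iterated ultrapowers *)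

Section cylinder.
Context (A : Type).
Implicit Types (s u : nat -> A).

Definition scons (a : A) s : nat -> A := fun n => if n is k.+1 then s k else a.

Definition stail s : nat -> A := fun n => s n.+1.

Fixpoint scat m u s : nat -> A :=
  if m is k.+1 then scons (u 0%N) (scat k (stail u) s) else s.

Definition cylinder (T : Type) k (f : (nat -> A) -> T) :=
  forall s s', (forall i, (i < k)%N -> s i = s' i) -> f s = f s'.

Lemma iter_stail k s i : iter k stail s i = s (k + i)%N.
Proof. by elim: k i => [//|k IH] i /=; rewrite /stail IH addnS. Qed.

Lemma scatE m u s i : (i < m)%N -> scat m u s i = u i.
Proof. by elim: m u i => [//|m IH] u [//|i] /= /IH ->. Qed.

Lemma iter_stail_scat m u s : iter m stail (scat m u s) = s.
Proof. by elim: m u => [//|m IH] u; rewrite iterSr /= IH. Qed.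

Lemma cylinder_leq (T : Type) k k' (f : (nat -> A) -> T) :
  (k <= k')%N -> cylinder k f -> cylinder k' f.
Proof. by move=> kk' cf s s' ss'; apply: cf => i /leq_trans/(_ kk')/ss'. Qed.

Lemma cylinder_stail (T : Type) k (f : (nat -> A) -> T) m :
  cylinder k f -> cylinder (m + k)%N (fun s => f (iter m stail s)).
Proof.
move=> cf s s' ss'; apply: cf => i ik; rewrite !iter_stail.
by apply: ss'; rewrite ltn_add2l.
Qed.

Lemma cylinder_comp (T1 T2 T3 : Type) k (f : (nat -> A) -> T1)
    (g : (nat -> A) -> T2) (h : T1 -> T2 -> T3) :
  cylinder k f -> cylinder k g -> cylinder k (fun s => h (f s) (g s)).
Proof. by move=> cf cg s s' ss'; rewrite (cf _ _ ss') (cg _ _ ss'). Qed.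

Context (U : set_system A) {UU : UltraFilter U}.

(** This is the [k]-fold Fubini product of [U] on the first [k] coordinates, with the quantifier on
    [s 0] outermost. *)
Fixpoint iterated_near k (B : set (nat -> A)) : Prop :=
  if k is l.+1 then U [set a | iterated_near l [set s | B (scons a s)]]
  else forall s, B s.

Lemma iterated_nearS k B B' :
  B `<=` B' -> iterated_near k B -> iterated_near k B'.
Proof.
elim: k B B' => [|k IH] B B' BB' /=; first by move=> hB s; exact: BB'.
by apply: filterS => a /=; apply: IH => s; exact: BB'.
Qed.

Lemma iterated_nearI k B B' :
  iterated_near k B -> iterated_near k B' -> iterated_near k (B `&` B').
Proof.
elim: k B B' => [|k IH] B B' /=; first by move=> hB hB' s; split.
by move=> h h'; apply: filterS (filterI h h') => a /= [] /IH; apply.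
Qed.

Lemma iterated_near_leq k k' B :
  (k <= k')%N -> iterated_near k B -> iterated_near k' B.
Proof.
elim: k k' B => [|k IH] k' B.
  move=> _; elim: k' B => [//|k' IH'] B /= hB.
  by apply: (@filterS _ U _ setT) filterT => a _ /=; apply: IH' => s; exact: hB.
case: k' => [//|k'] kk' /=; apply: filterS => a; exact: IH.
Qed.

Lemma iterated_near_ex k B : iterated_near k B -> B !=set0.
Proof.
elim: k B => [|k IH] B /=.
  by have [a _] := filter_ex (@filterT _ U _); move/(_ (fun=> a)); exists (fun=> a).
by move=> /filter_ex[a /= /IH[s Bs]]; exists (scons a s).
Qed.

(** Maximality of [U] is used once per coordinate; after [k] coordinates a cylinder set is empty or
    full. *)
Lemma iterated_near_cylinder k B :
  cylinder k B -> iterated_near k B \/ iterated_near k (~` B).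
Proof.
elim: k B => [|k IH] B cB /=.
  have [[s Bs]|nB] := pselect (B !=set0).
    by left=> s'; rewrite (cB s' s).
  by right=> s Bs; apply: nB; exists s.
have cBa a : cylinder k [set s | B (scons a s)].
  by move=> s s' ss'; apply: cB => -[//|i] ik; exact: ss'.
have [|h] := in_ultra_setVsetC [set a | iterated_near k [set s | B (scons a s)]] UU.
  by left.
right; apply: filterS h => a /= nBa.
by have [] := IH _ (cBa a).
Qed.

(** Choosing witnesses for the [m] outer quantifiers freezes the first [m] variables and keeps the
    other [n] generic. *)
Lemma iterated_near_scat m n B : iterated_near (m + n)%N B ->
  exists u, iterated_near n [set s | B (scat m u s)].
Proof.
elim: m B => [|m IH] B /=.
  by have [a _] := filter_ex (@filterT _ U _); exists (fun=> a).
by move=> /filter_ex[a /= /IH[u hu]]; exists (scons a u).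
Qed.

(* Among the ultrafilters on [nat -> A] that contain [iterated_near k] for all
   [k], all agree on the sets that depend on finitely many coordinates. *)
Lemma ultra_power_exists : exists W : set_system (nat -> A),
  UltraFilter W /\ forall k B, iterated_near k B -> W B.
Proof.
pose W0 : set_system (nat -> A) := [set B | exists k, iterated_near k B].
have W0F : ProperFilter W0.
  apply: Build_ProperFilter_ex => [B [k /iterated_near_ex]//|]; split.
  - by exists 0%N.
  - move=> B B' [k hk] [k' hk']; exists (maxn k k').
    by apply: iterated_nearI; [apply: iterated_near_leq hk|
      apply: iterated_near_leq hk']; rewrite ?leq_maxl ?leq_maxr.
  - by move=> B B' BB' [k hk]; exists k; exact: iterated_nearS hk.
have [W [WU W0W]] := ultraFilterLemma W0F.
by exists W; split => // k B hB; apply: W0W; exists k.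
Qed.

Context (W : set_system (nat -> A)) {WU : UltraFilter W}.
Hypothesis WE : forall k B, iterated_near k B -> W B.

Lemma cylinder_near k B : cylinder k B -> W B -> iterated_near k B.
Proof.
move=> cB WB; have [//|/WE WnB] := iterated_near_cylinder cB.
by have [s] := filter_meetP WB WnB.
Qed.

(** The shifted event ignores the first [m] coordinates, so [m] vacuous quantifiers are put in
    front. This is what makes the shift isometric on functions of finitely many variables. *)
Lemma near_iter_stail k B m :
  cylinder k B -> W B -> W [set s | B (iter m stail s)].
Proof.
move=> cB /(cylinder_near cB) hB; apply: (WE (k := (m + k)%N)).
elim: m => [//|m IH] /=.
apply: (@filterS _ U _ setT) filterT => a _ /=; apply: iterated_nearS IH => s /=.
by rewrite -iterS iterSr.
Qed.

Lemma near_coord (B : set A) m : U B -> W [set s | B (s m)].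
Proof.
move=> UB; have W0 : W [set s | B (s 0%N)].
  by apply: (WE (k := 1)) => /=; apply: filterS UB => a Ba s.
have c1 : cylinder 1 [set s | B (s 0%N)] by move=> s s' /= /(_ 0%N) ->.
have := near_iter_stail m c1 W0; apply: filterS => s /=.
by rewrite iter_stail addn0.
Qed.

Section shift_invariant.
Context (R : realType) (X : completeNormedModType R) (C : set X).
Hypothesis clC : closed C.

(** An approximant [f] of [y] with [k] variables is close to its [k]-th shift, because [y] is
    invariant under the shift. These two functions have disjoint variables, so fixing those of the
    first leaves a constant close to [f], hence to [y]. Constants of increasing precision form a
    Cauchy sequence in [C]. *)
Lemma shift_invariant_constant (y : (nat -> A) -> X) :
  (forall e, 0 < e -> exists f, [/\ exists k, cylinder k f, forall s, C (f s),
    W [set s | `|f s - y s| < e] & W [set s | `|f (stail s) - y s| < e]]) ->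
  exists2 x, C x & forall e, 0 < e -> W [set s | `|x - y s| < e].
Proof.
move=> Hy.
have approx e : 0 < e -> exists2 x, C x & W [set s | `|x - y s| < e].
  move=> e0; pose d := e / 8; have d0 : 0 < d by rewrite divr_gt0.
  have [f [[k cf] Cf fy _]] := Hy _ d0.
  have k0 : 0 < k%:R + 1 :> R by rewrite ltr_wpDl.
  (* The second approximant [g] is chosen after [k] is known: its [k] one-step shift errors, each
     below [2 * d'], add up to at most [2 * d]. *)
  pose d' := d / (k%:R + 1); have d'0 : 0 < d' by rewrite divr_gt0.
  have d'd : d' * (k%:R + 1) = d by rewrite /d' divfK// gt_eqF.
  have [g [[l cg] _ gy gty]] := Hy _ d'0.
  have step i : W [set s | `|g (iter i stail s) - g (iter i.+1 stail s)| < 2 * d'].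
    pose B := [set s | `|g s - g (stail s)| < 2 * d'].
    have cB : cylinder l.+1 B.
      apply: (cylinder_comp (f := g) (g := fun s => g (stail s))
        (fun a b => is_true (`|a - b| < 2 * d'))).
        exact: cylinder_leq cg.
      exact: (cylinder_stail (m := 1%N) cg).
    apply: (near_iter_stail i cB); apply: filterS (filterI gy gty) => s /= [h1 h2].
    have := ler_distD (y s) (g s) (g (stail s)); rewrite [`|y s - _|]distrC.
    by move: h1 h2; rewrite /B /=; lra.
  have steps i : W [set s | `|g s - g (iter i stail s)| <= i%:R * (2 * d')].
    elim: i => [|i IH].
      by apply: (@filterS _ W _ setT) filterT => s _ /=; rewrite subrr normr0 mul0r.
    apply: filterS (filterI IH (step i)) => s [/= h1 h2].
    have := ler_distD (g (iter i stail s)) (g s) (g (stail (iter i stail s))).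
    by move: h1 h2; rewrite -natr1; lra.
  have fg : W [set s | `|f s - g s| < d + d'].
    apply: filterS (filterI fy gy) => s /= [h1 h2].
    have := ler_distD (y s) (f s) (g s); rewrite [`|y s - _|]distrC.
    by move: h1 h2; lra.
  have fgk : W [set s | `|f (iter k stail s) - g (iter k stail s)| < d + d'].
    apply: (near_iter_stail (k := maxn k l)
      (B := [set s | `|f s - g s| < d + d'])) fg.
    apply: (cylinder_comp (fun a b => is_true (`|a - b| < d + d'))).
      exact: cylinder_leq (leq_maxl _ _) cf.
    exact: cylinder_leq (leq_maxr _ _) cg.
  have d'led : d' <= d by rewrite -d'd ler_peMr ?(ltW d'0)// lerDr.
  have ff : W [set s | `|f s - f (iter k stail s)| < 6 * d].
    apply: filterS (filterI fg (filterI (steps k) fgk)) => s [/= h1 [/= h2 h3]].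
    have := ler_distD (g s) (f s) (f (iter k stail s)).
    have := ler_distD (g (iter k stail s)) (g s) (f (iter k stail s)).
    rewrite [`|g (iter _ _ _) - f _|]distrC => h4 h5.
    have : k%:R * d' <= d by rewrite -d'd mulrC ler_pM2l// lerDl.
    by move: h1 h2 h3 h4 h5 d0 d'led; clear; lra.
  (* The first [k] variables of [f s] are frozen at [u], while the [k]-th shift turns [scat k u s]
     back into a generic [s]. *)
  have /iterated_near_scat[u hu] : iterated_near (k + k)%N
      [set s | `|f s - f (iter k stail s)| < 6 * d].
    apply: cylinder_near ff.
    apply: (cylinder_comp (f := f) (g := fun s => f (iter k stail s))
      (fun a b => is_true (`|a - b| < 6 * d))).
      exact: cylinder_leq (leq_addl _ _) cf.
    exact: cylinder_stail.
  exists (f u) => //; apply: filterS (filterI (WE hu) fy) => s [/=].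
  rewrite iter_stail_scat (cf (scat k u s) u); last exact: scatE.
  move=> h1 h2; have := ler_distD (f s) (f u) (y s).
  by move: h1 h2 d0; rewrite /d; lra.
have h0 n : 0 < 2^-1 ^+ n.+2 :> R by rewrite exprn_gt0.
have /choice[x xP] : forall n, exists x, C x /\ W [set s | `|x - y s| < 2^-1 ^+ n.+2].
  by move=> n; have [x] := approx _ (h0 n); exists x.
have [|l hl] := @geometric_cauchy _ X x 1.
  move=> n; have [_ h1] := xP n; have [_ h2] := xP n.+1.
  have [s /= h3 h4] := filter_meetP h1 h2.
  have := ler_distD (y s) (x n.+1) (x n); rewrite [`|y s - _|]distrC.
  by move: h3 h4 (h0 n); rewrite !exprS; lra.
exists l.
  move/closed_normP : (clC); apply => e /exists_half_expr_lt[n hn].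
  exists (x n.+1); first by have [] := xP n.+1.
  rewrite distrC; apply: le_lt_trans (hl _) _.
  by move: hn; rewrite exprS; lra.
move=> e /exists_half_expr_lt[n hn]; have [_] := xP n.+2.
apply: filterS => s /= h1; have := ler_distD (x n.+2) l (y s).
rewrite [`|l - x _|]distrC => /le_lt_trans; apply.
by have := hl n.+2; move: h1 hn (h0 n); rewrite !exprS; lra.
Qed.

End shift_invariant.
End cylinder.

(** * Weak limits *)

Section weak_limit.
Context (R : realType) (X : completeNormedModType R).
Hypothesis SX : super_fixed_point_property X.
Context (C : set X) (B : R) (A : Type) (U : set_system A) {UU : UltraFilter U}.
Hypothesis CB : forall x, C x -> `|x| <= B.
Hypothesis clC : closed C.
Hypothesis cC : forall x y t, C x -> C y -> 0 <= t -> t <= 1 ->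
  C (t *: x + (1 - t) *: y).

Definition cesaro N (f : (nat -> A) -> X) s :=
  N.+1%:R^-1 *: \sum_(i < N.+1) f (iter i (@stail A) s).

Lemma cesaroB N f g s : cesaro N f s - cesaro N g s =
  cesaro N (fun s => f s - g s) s.
Proof. by rewrite /cesaro -scalerBr sumrB. Qed.

Lemma norm_cesaro_le N f s c :
  (forall i : 'I_N.+1, `|f (iter i (@stail A) s)| <= c) -> `|cesaro N f s| <= c.
Proof.
move=> fc; rewrite /cesaro normrZ gtr0_norm ?invr_gt0// ler_pdivrMl//.
apply: le_trans (ler_norm_sum _ _ _) _.
apply: le_trans (ler_sum _ (fun i _ => fc i)) _.
by rewrite sumr_const card_ord -[c *+ _]mulr_natl.
Qed.

Lemma cesaro_cst N (c : X) s : cesaro N (fun=> c) s = c.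
Proof.
by rewrite /cesaro sumr_const card_ord -[c *+ _]scaler_nat scalerA mulVf// scale1r.
Qed.

Lemma cesaro_lin N k f l g s : cesaro N (fun s => k *: f s + l *: g s) s =
  k *: cesaro N f s + l *: cesaro N g s.
Proof.
rewrite /cesaro big_split /= -!scaler_sumr scalerDr !scalerA.
by rewrite [k * _]mulrC [l * _]mulrC.
Qed.

Lemma norm_cesaro_stail N f s : (forall s, C (f s)) ->
  `|cesaro N (fun s => f (stail s)) s - cesaro N f s| <= 2 * B / N.+1%:R.
Proof.
move=> Cf; rewrite /cesaro -scalerBr normrZ gtr0_norm ?invr_gt0// mulrC.
rewrite ler_pM2r ?invr_gt0//.
rewrite -[\sum_(i < N.+1) f (stail _)](big_mkord xpredT
  (fun i => f (iter i.+1 (@stail A) s))).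
rewrite -[\sum_(i < N.+1) f _](big_mkord xpredT (fun i => f (iter i (@stail A) s))).
rewrite -sumrB telescope_sumr//.
apply: le_trans (ler_normB _ _) _.
by rewrite (_ : 2 * B = B + B); [apply: lerD; exact: CB|ring].
Qed.

Context (W : set_system (nat -> A)) {WU : UltraFilter W}.
Hypothesis WE : forall k D, iterated_near U k D -> W D.

(* A fixed point of the shift in the closed convex hull of the coordinates
   [x (s i)] is a constant by [shift_invariant_constant]; as in the mean ergodic
   theorem it is the limit of the Cesaro means. *)
Lemma cesaro_limit (x : A -> X) : (forall a, C (x a)) ->
  exists2 l, C l & forall e, 0 < e -> exists N0, forall N, (N0 <= N)%N ->
    W [set s | `|cesaro N (fun s => x (s 0%N)) s - l| < e].
Proof.
move=> Cx; pose xi (s : nat -> A) := x (s 0%N).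
(* [Q] plays the role of the convex hull of the coordinates: it is convex, stable under the shift
   and contains [xi], and its last condition records that the Cesaro means are asymptotically those
   of [xi]. *)
pose Q : set ((nat -> A) -> X) := [set f | [/\ exists k, cylinder k f,
  forall s, C (f s) & forall e, 0 < e -> exists N0, forall N, (N0 <= N)%N ->
    W [set s | `|cesaro N f s - cesaro N xi s| < e]]].
have Qxi : Q xi.
  split; [by exists 1%N => s s' /(_ 0%N) ss'; rewrite /xi ss'|by move=> s; exact: Cx|].
  move=> e e0; exists 0%N => N _.
  by apply: (@filterS _ W _ setT) filterT => s _ /=; rewrite subrr normr0.
have Qb f : Q f -> forall s, `|f s| <= B by move=> [_ Cf _] s; exact: CB.
have Qconv f g t : Q f -> Q g -> 0 <= t -> t <= 1 ->
    Q (fun s => t *: f s + (1 - t) *: g s).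
  move=> [[k cf] Cf fxi] [[l cg] Cg gxi] t0 t1; split.
  - exists (maxn k l).
    apply: (cylinder_comp (fun a b => t *: a + (1 - t) *: b)).
      exact: cylinder_leq (leq_maxl _ _) cf.
    exact: cylinder_leq (leq_maxr _ _) cg.
  - by move=> s; exact: cC.
  - move=> e e0; have [M fM] := fxi _ e0; have [N gN] := gxi _ e0.
    exists (maxn M N) => n; rewrite geq_max => /andP[/fM fn /gN gn].
    apply: filterS (filterI fn gn) => s /= [h1 h2].
    rewrite cesaro_lin (_ : _ - _ = t *: (cesaro n f s - cesaro n xi s) +
      (1 - t) *: (cesaro n g s - cesaro n xi s)); last first.
      rewrite !scalerBr addrACA -opprD -scalerDl.
      by rewrite (_ : t + (1 - t) = 1) ?scale1r//; ring.
    apply: le_lt_trans (ler_normD _ _) _; rewrite !normrZ !ger0_norm ?subr_ge0//.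
    have [->|t0'] := eqVneq t 0; first by rewrite mul0r add0r subr0 mul1r.
    have {}t0' : 0 < t by rewrite lt_neqAle eq_sym t0'.
    have h3 : t * `|cesaro n f s - cesaro n xi s| < t * e by rewrite ltr_pM2l.
    have h4 : (1 - t) * `|cesaro n g s - cesaro n xi s| <= (1 - t) * e.
      by rewrite ler_wpM2l ?subr_ge0// ltW.
    by move: h3 h4; lra.
have Qstail f : Q f -> Q (fun s => f (stail s)).
  move=> [[k cf] Cf fxi]; split.
  - by exists (1 + k)%N; exact: (cylinder_stail (m := 1%N) cf).
  - by move=> s; exact: Cf.
  - move=> e e0; have e20 : 0 < e / 2 by rewrite divr_gt0.
    have [M fM] := fxi _ e20.
    (* The means of [f] and of its shift differ by two boundary terms divided by [N.+1]; beyond [K]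
       this is at most [e / 2]. The absolute value makes the argument of [Num.bound] nonnegative. *)
    pose K := Num.bound (4 * `|B| / e).
    have K0 : 4 * `|B| / e < K%:R by apply: archi_boundP; rewrite divr_ge0// ltW.
    exists (maxn M K) => N; rewrite geq_max => /andP[/fM fN KN].
    apply: filterS fN => s /= h1.
    have := ler_distD (cesaro N f s) (cesaro N (fun s => f (stail s)) s)
      (cesaro N xi s).
    have h2 : 2 * B / N.+1%:R <= e / 2.
      rewrite ler_pdivrMr// (le_trans (y := 2 * `|B|))//.
        by rewrite ler_pM2l// ler_norm.
      move: K0; rewrite ltr_pdivrMr// => K0.
      have : K%:R * e <= N.+1%:R * e by rewrite ler_pM2r// ler_nat leqW.
      have aux (b p n d : R) : 4 * b < p * d -> p * d <= n * d -> 2 * b <= d / 2 * n.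
        by lra.
      exact: aux K0.
    move=> /le_lt_trans; apply; rewrite [e]splitr; apply: ler_ltD => //.
    exact: le_trans (norm_cesaro_stail N s Cf) h2.
have Qne f g c : Q f -> Q g -> W [set s | `|f s - g s| < c] ->
    W [set s | `|f (stail s) - g (stail s)| < c].
  move=> [[k cf] _ _] [[l cg] _ _].
  apply: (near_iter_stail WE 1%N (k := maxn k l)
    (B := [set s | `|f s - g s| < c])).
  apply: (cylinder_comp (fun a b => is_true (`|a - b| < c))).
    exact: cylinder_leq (leq_maxl _ _) cf.
  exact: cylinder_leq (leq_maxr _ _) cg.
have Q0 : Q !=set0 by exists xi.
have [y by_ yP] := ultrapower_fixed_point WU SX Q0 Qb Qconv Qstail Qne.
have [|l Cl ly] := shift_invariant_constant WE clC (y := y).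
  move=> e /yP[f [[cf Cf _] fy fty]]; by exists f.
exists l => // e e0; have e40 : 0 < e / 4 by rewrite divr_gt0.
have [f [Qf fy _]] := yP _ e40.
have [[k cf] Cf fxi] := Qf.
(* Some [f] in [Q] is close to the constant [l]. By shift invariance so are its first shifts, hence
   its Cesaro means, hence those of [xi]. *)
have fl : W [set s | `|f s - l| < e / 2].
  apply: filterS (filterI fy (ly _ e40)) => s /= [h1 h2].
  have := ler_distD (y s) (f s) l; rewrite [`|y s - l|]distrC.
  by move: h1 h2; lra.
have [M fM] := fxi _ e40; exists M => N /fM fN.
have flN : W [set s | forall i : 'I_N.+1, `|f (iter i (@stail A) s) - l| < e / 2].
  apply: filter_forall => i.
  apply: (near_iter_stail WE (k := k) (B := [set s | `|f s - l| < e / 2])) fl.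
  by move=> s s' ss' /=; rewrite (cf _ _ ss').
apply: filterS (filterI fN flN) => s [/= h1 h2].
have : `|cesaro N f s - l| <= e / 2.
  rewrite -[l in X in X <= _](cesaro_cst N l s) cesaroB; apply: norm_cesaro_le => i.
  exact: ltW.
have := ler_distD (cesaro N f s) (cesaro N xi s) l.
by rewrite [`|cesaro N xi s - cesaro _ _ _|]distrC; move: h1 e0; lra.
Qed.

End weak_limit.

(** [P x] is the limit of the Cesaro means of [x (s 0)], [x (s 1)], and so on. A bound valid for
    [U]-almost all [a] holds at finitely many generic coordinates at once, so it passes to the means
    and to [P]. This operator takes the place of a weak limit along [U]. *)
Lemma nonexpansive_ultralimit (R : realType) (X : completeNormedModType R)
    (C : set X) (A : Type) (U : set_system A) :
  super_fixed_point_property X -> UltraFilter U ->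
  bounded_set C -> closed C -> convex_set (C : set (convex_lmodType X)) ->
  exists P : (A -> X) -> X, [/\ forall x, (forall a, C (x a)) -> C (P x),
    forall x y c, (forall a, C (x a)) -> (forall a, C (y a)) ->
      U [set a | `|x a - y a| <= c] -> `|P x - P y| <= c
    & forall c, C c -> P (fun=> c) = c].
Proof.
move=> SX UU /bounded_set_normP[B CB] clC /convex_set_combP cC.
have [W [WU WE]] := ultra_power_exists (U := U).
have /choice[P PP] : forall x : A -> X, exists l, (forall a, C (x a)) ->
    C l /\ forall e, 0 < e -> exists N0, forall N, (N0 <= N)%N ->
    W [set s | `|cesaro N (fun s => x (s 0%N)) s - l| < e].
  move=> x; have [Cx|] := pselect (forall a, C (x a)); last by exists 0.
  by have [l] := cesaro_limit SX CB clC cC WE Cx; exists l.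
exists P; split=> [x /PP[]//|x y c Cx Cy xy|c Cc].
- have [_ Px] := PP x Cx; have [_ Py] := PP y Cy.
  apply/ler_addgt0Pr => e e0; have e20 : 0 < e / 2 by rewrite divr_gt0.
  have [M1 /(_ (maxn M1 _) (leq_maxl _ _)) hx] := Px _ e20.
  have [M2 /(_ (maxn _ M2) (leq_maxr _ _)) hy] := Py _ e20.
  have xyN N : W [set s : nat -> A | forall i : 'I_N, `|x (s i) - y (s i)| <= c].
    apply: filter_forall => i.
    exact: (near_coord WE (B := [set a | `|x a - y a| <= c])).
  set N := maxn M1 M2.
  have [s [/= h1 h2] h3] := filter_meetP (filterI (hx M2) (hy M1)) (xyN N.+1).
  have h4 : `|cesaro N (fun s => x (s 0%N)) s - cesaro N (fun s => y (s 0%N)) s| <= c.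
    rewrite cesaroB; apply: norm_cesaro_le => i.
    by rewrite !iter_stail addn0; exact: h3.
  have := ler_distD (cesaro N (fun s => x (s 0%N)) s) (P x) (P y).
  have := ler_distD (cesaro N (fun s => y (s 0%N)) s)
    (cesaro N (fun s => x (s 0%N)) s) (P y).
  rewrite [`|P x - cesaro _ _ _|]distrC.
  move: h1 h2 h4; rewrite -/N; lra.
- have [_ Pc] := PP (fun=> c) (fun=> Cc).
  apply/eqP; rewrite -subr_eq0 -normr_le0; apply/ler_addgt0Pr => e /Pc[N].
  move=> /(_ N (leqnn N)) /filter_ex[s /=].
  by rewrite cesaro_cst distrC add0r => /ltW.
Qed.

(** * Commuting nonexpansive maps *)

Section convex_body.
Context (R : realType) (X : completeNormedModType R).
Implicit Types (K : set X) (S : set (X -> X)).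

Definition convex_body K := [/\ K !=set0, bounded_set K, closed K &
  convex_set (K : set (convex_lmodType X))].

Definition nonexpansive_self K (f : X -> X) := set_fun K K f /\ nonexpansive K f.

Definition fixed_by S (x : X) := forall f, S f -> f x = x.

Hypothesis SX : super_fixed_point_property X.

Lemma nonexpansive_fixed_point K f : convex_body K -> nonexpansive_self K f ->
  exists2 x, K x & f x = x.
Proof.
move=> [K0 bK clK cK] [fK fne].
exact: (SX (@finitely_representable_refl R X)) K0 bK clK cK fK fne.
Qed.

Definition retraction_on_fixed K S (r : X -> X) := [/\ nonexpansive_self K r,
  forall x, K x -> fixed_by S (r x) & forall x, K x -> fixed_by S x -> r x = x].

Definition fixing K S (f : X -> X) := nonexpansive_self K f /\
  forall x, K x -> fixed_by S x -> f x = x.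

Lemma fixing_id K S : fixing K S id.
Proof. by split => //; split => // x y. Qed.

Lemma fixing_comp K S f g : fixing K S f -> fixing K S g -> fixing K S (f \o g).
Proof.
move=> [[fK fne] fF] [[gK gne] gF]; split; first split.
- by move=> x Kx /=; apply: fK; exact: gK.
- by move=> x y Kx Ky /=; apply: le_trans (gne _ _ Kx Ky); apply: fne; exact: gK.
- by move=> x Kx Fx /=; rewrite (gF _ Kx Fx) fF.
Qed.

(* Zorn's lemma for the preorder |f x - f y| <= |g x - g y|; a chain has the
   limit of [nonexpansive_ultralimit] as a lower bound. *)
Lemma fixing_minimal K S : convex_body K -> exists2 r, fixing K S r &
  forall f, fixing K S f -> forall x y, K x -> K y ->
    `|r x - r y| <= `|f (r x) - f (r y)|.
Proof.
move=> [K0 bK clK cK].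
pose T := {f : X -> X | fixing K S f}.
(* The order is reversed: [g] is above [f] if it contracts at least as much, so the maximal elements
   of Zorn's lemma are the minimal maps sought. *)
pose le (f g : T) := forall x y, K x -> K y ->
  `|sval g x - sval g y| <= `|sval f x - sval f y|.
pose leb (f g : T) := `[< le f g >].
have le_refl f : leb f f by apply/asboolP => x y _ _.
have le_tr f g h : leb f g -> leb g h -> leb f h.
  move=> /asboolP fg /asboolP gh; apply/asboolP => x y Kx Ky.
  exact: le_trans (gh _ _ Kx Ky) (fg _ _ Kx Ky).
pose id0 : T := exist _ id (fixing_id K S).
have [|[r rN] rmin] := ZL_preorder id0 le_refl le_tr.
  move=> D Dtot; have [D0|/set0P/negP] := pselect (D !=set0); last first.
    by rewrite negbK => /eqP ->; exists id0.
  (* The filter of tails of the chain [D]; a limit along it contracts at least as much as every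
     member of [D]. *)
  pose U0 : set_system T := [set V | exists2 g0, D g0 &
    forall g, D g -> le g0 g -> V g].
  have U0F : ProperFilter U0.
    apply: Build_ProperFilter_ex => [V [g0 Dg0 hV]|].
      by exists g0; apply: hV => // x y.
    split.
    - by have [g Dg] := D0; exists g.
    - move=> V V' [g Dg hg] [g' Dg' hg'].
      have [/asboolP gg'|/asboolP g'g] := Dtot _ _ Dg Dg'.
        exists g' => // h Dh g'h; split; last exact: hg'.
        apply: hg => // x y Kx Ky; exact: le_trans (g'h _ _ Kx Ky) (gg' _ _ Kx Ky).
      exists g => // h Dh gh; split; first exact: hg.
      apply: hg' => // x y Kx Ky; exact: le_trans (gh _ _ Kx Ky) (g'g _ _ Kx Ky).
    - by move=> V V' VV' [g Dg hg]; exists g => // h Dh gh; apply: VV'; exact: hg.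
  have [U [UU U0U]] := ultraFilterLemma U0F.
  have [P [PK Pne Pcst]] := nonexpansive_ultralimit SX UU bK clK cK.
  pose f x := P (fun g : T => sval g x).
  have gK x (g : T) : K x -> K (sval g x) by case: g => g [[gK _] _] /= /gK.
  have fle g x y : D g -> K x -> K y -> `|f x - f y| <= `|sval g x - sval g y|.
    move=> Dg Kx Ky; apply: Pne; try by move=> h; exact: gK.
    by apply: U0U; exists g => // h _; apply.
  have fN : fixing K S f.
    split; first split.
    - by move=> x Kx; apply: PK => g; exact: gK.
    - move=> x y Kx Ky; have [g Dg] := D0; apply: le_trans (fle g _ _ Dg Kx Ky) _.
      by case: (g) => h [[_ hne] _] /=; exact: hne.
    - move=> x Kx Fx; rewrite /f (_ : (fun g : T => _) = fun=> x) ?Pcst//.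
      by apply/funext => -[g [_ gF]] /=; exact: gF.
  exists (exist _ f fN) => g Dg; apply/asboolP => x y Kx Ky /=; exact: fle.
exists r => // f fN x y Kx Ky.
have [[rK rne] _] := rN.
have [[fK fne] _] := fN.
(* [f \o r] is above [r] in this order, so maximality of [r] yields the reverse comparison, which is
   the claim. *)
pose fr : T := exist _ (f \o r) (fixing_comp fN rN).
have /rmin/asboolP/(_ x y Kx Ky) // : leb (exist _ r rN) fr.
by apply/asboolP => u v Ku Kv /=; apply: fne; exact: rK.
Qed.

(** The monoid is closed under convex combinations and under pointwise [P]-limits. If [f n x] tends
    to [z], then [z] is the image of [x] under the map sending [y] to the [P]-limit of [f n y],
    which is again in the monoid; hence the orbit is closed. *)
Lemma fixing_orbit_body K S x : convex_body K -> K x ->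
  convex_body [set z | exists2 f, fixing K S f & z = f x].
Proof.
move=> [K0 bK clK cK] Kx.
have [M KM] := (bounded_set_normP K).1 bK.
split.
- by exists x; exists id => //; exact: fixing_id.
- apply/bounded_set_normP; exists M => z [f [[fK _] _] ->].
  by apply: KM; exact: fK.
- apply/closed_normP => z zK.
  have [U [UU ooU]] := ultraFilterLemma (@eventually_filter).
  have [P [PK Pne Pcst]] := nonexpansive_ultralimit SX UU bK clK cK.
  have h0 n : 0 < 2^-1 ^+ n :> R by rewrite exprn_gt0.
  have /choice[f fP] : forall n, exists f, fixing K S f /\ `|z - f x| < 2^-1 ^+ n.
    by move=> n; have [_ [f fN ->] zf] := zK _ (h0 n); exists f.
  have Kz : K z.
    move/closed_normP : (clK); apply => e /exists_half_expr_lt[n hn].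
    have [[[fK _] _] zf] := fP n; exists (f n x); first exact: fK.
    exact: lt_trans hn.
  have fK n y : K y -> K (f n y) by move=> Ky; have [[[fK _] _] _] := fP n; exact: fK.
  exists (fun y => P (fun n => f n y)).
    split; first split.
    - by move=> y Ky; apply: PK => n; exact: fK.
    - move=> u v Ku Kv; apply: Pne; try by move=> n; exact: fK.
      apply: (@filterS _ U _ setT) filterT => n _ /=.
      by have [[[_ fne] _] _] := fP n; exact: fne.
    - move=> y Ky Fy; rewrite (_ : (fun n => _) = fun=> y) ?Pcst//.
      by apply/funext => n; have [[_ fF] _] := fP n; exact: fF.
  apply/eqP; rewrite -subr_eq0 -normr_le0; apply/ler_addgt0Pr => e e0.
  rewrite add0r -[z in X in X <= _](Pcst z Kz); apply: Pne => //.
    by move=> n; exact: fK.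
  have [N hN] := exists_half_expr_lt e0; apply: ooU; exists N => // n /= Nn.
  have [_ zf] := fP n; apply: ltW; apply: lt_le_trans zf _.
  apply: le_trans (ltW hN); rewrite -(subnKC Nn) exprD ler_piMr ?(ltW (h0 N))//.
  by apply: exprn_ile1; lra.
- apply/convex_set_combP => _ _ t [f [[fK fne] fF] ->] [g [[gK gne] gF] ->] t0 t1.
  move/convex_set_combP : cK => cK.
  exists (fun y => t *: f y + (1 - t) *: g y) => //; split; first split.
  - by move=> y Ky; apply: cK => //; [exact: fK|exact: gK].
  - move=> u v Ku Kv; rewrite opprD addrACA -!scalerBr.
    apply: le_trans (ler_normD _ _) _; rewrite !normrZ !ger0_norm ?subr_ge0//.
    rewrite (_ : `|u - v| = t * `|u - v| + (1 - t) * `|u - v|); last by ring.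
    by apply: lerD; apply: ler_wpM2l; rewrite ?subr_ge0//; [exact: fne|exact: gne].
  - move=> y Ky Fy; rewrite fF// gF// -scalerDl.
    by rewrite (_ : t + (1 - t) = 1) ?scale1r//; ring.
Qed.

(* Bruck's argument: the orbit of [r x] under the monoid [fixing K S] contains a
   common fixed point [p = f (r x)], and minimality of [r] makes [f] isometric
   on the pair [r x], [r p = p]. *)
Lemma nonexpansive_retraction K S : convex_body K ->
  (forall f, S f -> nonexpansive_self K f) ->
  (forall K', convex_body K' -> K' `<=` K -> (forall f, S f -> set_fun K' K' f) ->
    exists2 x, K' x & fixed_by S x) ->
  exists r, retraction_on_fixed K S r.
Proof.
move=> bodyK SK hered; have [r rN rmin] := fixing_minimal S bodyK.
have [[rK rne] rF] := rN; exists r; split => // x Kx.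
have [||_ [f fN ->] Fp] := hered _ (fixing_orbit_body S bodyK (rK _ Kx)).
- by move=> _ [f [[fK _] _] ->]; apply: fK; exact: rK.
- move=> g Sg _ [f fN ->]; exists (g \o f) => //.
  apply: fixing_comp fN; split; first exact: SK.
  by move=> y _; exact.
have [[fK _] fF] := fN.
have Kp := fK _ (rK _ Kx).
have := rmin f fN x _ Kx Kp; rewrite (rF _ Kp Fp) (fF _ Kp Fp) subrr normr0.
by rewrite normr_le0 subr_eq0 => /eqP ->.
Qed.

Definition commuting_on K S := forall f g x, S f -> S g -> K x ->
  f (g x) = g (f x).

Lemma commuting_on_sub K K' S S' : K' `<=` K -> S' `<=` S ->
  commuting_on K S -> commuting_on K' S'.
Proof. by move=> KK SS cS f g x /SS Sf /SS Sg /KK Kx; exact: (cS _ _ _ Sf Sg Kx). Qed.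

(** With [r] a retraction on the fixed points of [J], take a fixed point [y] of [g \o r]. Since [g]
    commutes with [J], [y = g (r y)] is fixed by [J]; then [r y = y] and [g y = y]. The induction
    ranges over all [K], since the retraction needs the result on every invariant convex body inside
    [K]. *)
Lemma finite_common_fixed_point (J : seq (X -> X)) K : convex_body K ->
  (forall f, List.In f J -> nonexpansive_self K f) ->
  commuting_on K [set f | List.In f J] ->
  exists2 x, K x & fixed_by [set f | List.In f J] x.
Proof.
elim: J K => [|g J IH] K bodyK JK comJ.
  by have [[x Kx] _ _ _] := bodyK; exists x.
have JJ f : List.In f J -> List.In f (g :: J) by right.
have [|K' bodyK' K'K JK'|r [[rK rne] rF Fr]] :=
  nonexpansive_retraction (S := [set f | List.In f J]) bodyK.
- by move=> f /JJ /JK.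
- apply: IH => //; last first.
    by refine (commuting_on_sub K'K _ comJ) => f; exact: JJ.
  move=> f Jf; split; first exact: JK'.
  by have [_ fne] := JK _ (JJ _ Jf) => u v /K'K Ku /K'K Kv; exact: fne.
have [gK gne] := JK g (or_introl erefl).
have [|y Ky gry] := nonexpansive_fixed_point (f := g \o r) bodyK.
  split=> [x Kx|u v Ku Kv] /=; first by apply: gK; exact: rK.
  by apply: le_trans (rne _ _ Ku Kv); apply: gne; exact: rK.
have Fy : fixed_by [set f | List.In f J] y.
  move=> f Jf; rewrite -gry /= (comJ f g)//; [|exact: JJ|by left|exact: rK].
  by rewrite (rF y Ky f Jf).
exists y => // f [<-|/Fy//].
by rewrite -[in RHS]gry /= (Fr _ Ky Fy).
Qed.

End convex_body.

(* With [r J] a retraction on the common fixed points of the finite family [J],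
   the map [F u s = r (s 0) (u (stail s))] satisfies [F (F u) s = F u (stail s)]
   for almost all [s], since [r J] fixes the range of [r J'] when [J'] contains
   [J]; its fixed points are therefore invariant under the shift. *)
Lemma commuting_fixed_point (R : realType) (X : completeNormedModType R)
    (K : set X) (S : set (X -> X)) :
  super_fixed_point_property X -> convex_body K ->
  (forall f, S f -> nonexpansive_self K f) -> commuting_on K S ->
  exists2 x, K x & fixed_by S x.
Proof.
move=> SX bodyK SK comS.
have [[z0 Kz0] bK clK cK] := bodyK.
pose In (J : seq (X -> X)) : set (X -> X) := [set f | List.In f J].
(* For [J] not contained in [S] the default is [id], so that [r J] is a nonexpansive self-map of [K]
   for every [J]. *)
have /choice[r rP] : forall J, exists r, nonexpansive_self K r /\
    (In J `<=` S -> retraction_on_fixed K (In J) r).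
  move=> J; have [JS|] := pselect (In J `<=` S); last first.
    by move=> nJS; exists id; split => //; split => // x y.
  have [|K' bodyK' K'K JK'|r rJ] := nonexpansive_retraction (S := In J) SX bodyK.
  - by move=> f /JS /SK.
  - apply: (finite_common_fixed_point SX) => //.
      move=> f Jf; split; first exact: JK'.
      by have [_ fne] := SK _ (JS _ Jf) => u v /K'K Ku /K'K Kv; exact: fne.
    by refine (commuting_on_sub K'K JS comS).
  - by exists r; split => //; case: rJ.
have rK J x : K x -> K (r J x) by move=> Kx; have [[rK _] _] := rP J; exact: rK.
have rne J x y : K x -> K y -> `|r J x - r J y| <= `|x - y|.
  by move=> Kx Ky; have [[_ rne] _] := rP J; exact: rne.
(* The filter of upper cones among finite subfamilies of [S] ordered by inclusion. *)
pose U0 : set_system (seq (X -> X)) := [set V | exists2 J0, In J0 `<=` S &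
  forall J, In J `<=` S -> In J0 `<=` In J -> V J].
have InU J J' : In (J ++ J') = In J `|` In J'.
  by apply/seteqP; split=> f /(List.in_app_iff J J' f).
have U0F : ProperFilter U0.
  apply: Build_ProperFilter_ex => [V [J JS hV]|]; first by exists J; exact: hV.
  split.
  - by exists [::].
  - move=> V V' [J JS hV] [J' JS' hV']; exists (J ++ J').
      by rewrite InU => f [/JS|/JS'].
    by move=> I IS; rewrite InU subUset => -[JI J'I]; split; [exact: hV|exact: hV'].
  - by move=> V V' VV' [J JS hV]; exists J => // I IS JI; apply: VV'; exact: hV.
have [U [UU U0U]] := ultraFilterLemma U0F.
have USub J0 : In J0 `<=` S -> U [set J | In J `<=` S /\ In J0 `<=` In J].
  by move=> J0S; apply: U0U; exists J0.
have [W [WU WE]] := ultra_power_exists (U := U).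
pose Q : set ((nat -> seq (X -> X)) -> X) :=
  [set u | (exists k, cylinder k u) /\ forall s, K (u s)].
pose F (u : (nat -> seq (X -> X)) -> X) s := r (s 0%N) (u (stail s)).
have [B KB] := (bounded_set_normP K).1 bK.
have Q0 : Q !=set0 by exists (fun=> z0); split => //; exists 0%N.
have QB u : Q u -> forall s, `|u s| <= B by move=> [_ Ku] s; exact: KB.
have Qc u v t : Q u -> Q v -> 0 <= t -> t <= 1 ->
    Q (fun s => t *: u s + (1 - t) *: v s).
  move=> [[k cu] Ku] [[l cv] Kv] t0 t1; split; last first.
    by move=> s; move/convex_set_combP : cK; exact.
  exists (maxn k l); apply: (cylinder_comp (fun a b => t *: a + (1 - t) *: b)).
    exact: cylinder_leq (leq_maxl _ _) cu.
  exact: cylinder_leq (leq_maxr _ _) cv.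
have QF u : Q u -> Q (F u).
  move=> [[k cu] Ku]; split; last by move=> s; exact: rK.
  exists k.+1 => s s' ss'; rewrite /F ss'//; congr (r _ _); apply: cu => i ik.
  exact: ss'.
have Fne u v c : Q u -> Q v -> W [set s | `|u s - v s| < c] ->
    W [set s | `|F u s - F v s| < c].
  move=> [[k cu] Ku] [[l cv] Kv] uv.
  have : W [set s | `|u (stail s) - v (stail s)| < c].
    apply: (near_iter_stail WE 1%N (k := maxn k l)
      (B := [set s | `|u s - v s| < c])) uv.
    apply: (cylinder_comp (fun a b => is_true (`|a - b| < c))).
      exact: cylinder_leq (leq_maxl _ _) cu.
    exact: cylinder_leq (leq_maxr _ _) cv.
  by apply: filterS => s /=; apply: le_lt_trans; exact: rne.
have [y _ yP] := ultrapower_fixed_point WU SX Q0 QB Qc QF Fne.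
(* Since [s 1] is chosen generically after [s 0], it contains [s 0] almost surely. *)
have W01 : W [set s | (In (s 0%N) `<=` S) /\
    (In (s 1%N) `<=` S /\ In (s 0%N) `<=` In (s 1%N))].
  apply: (WE 2%N) => /=; apply: filterS (USub [::] _) => // J [JS _].
  by apply: filterS (USub J JS) => J' [J'S JJ'] s.
have approx e : 0 < e -> exists u, [/\ Q u, W [set s | `|F u s - y s| < e] &
    W [set s | `|F u (stail s) - y s| < e]].
  move=> e0; have e30 : 0 < e / 3 by rewrite divr_gt0.
  have [u [Qu uy Fuy]] := yP _ e30; have [_ Ku] := Qu.
  exists u; split => //.
    by apply: filterS Fuy => s /= /lt_trans; apply; rewrite ltr_pdivrMr// ltr_pMr// ltr1n.
  have uFu : W [set s | `|F u s - u s| < e / 3 + e / 3].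
    apply: filterS (filterI uy Fuy) => s /= [h1 h2].
    have := ler_distD (y s) (F u s) (u s); rewrite [`|y s - _|]distrC.
    by move: h1 h2; clear; lra.
  have := Fne _ _ _ (QF _ Qu) Qu uFu => FFu.
  apply: filterS (filterI W01 (filterI FFu Fuy)) => s [[s0S [s1S s01]]] /= [h1 h2].
  have FFE : F (F u) s = F u (stail s).
    have [_ _ rid] := (rP (s 0%N)).2 s0S.
    have [_ rfix _] := (rP (s 1%N)).2 s1S.
    have Kz := Ku (stail (stail s)).
    rewrite /F; apply: rid; first exact: rK.
    by move=> f /s01 s1f; exact: rfix.
  have := ler_distD (F u s) (F u (stail s)) (y s).
  by rewrite -FFE; move: h1 h2; clear; lra.
have [|x Kx xy] := shift_invariant_constant WE clK (y := y).
  by move=> e /approx[u [Qu h1 h2]]; exists (F u); have [] := QF _ Qu.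
exists x => // g Sg; apply/eqP; rewrite -subr_eq0 -normr_le0.
apply/ler_addgt0Pr => e e0; rewrite add0r.
have e40 : 0 < e / 4 by rewrite divr_gt0.
have [u [Qu Fuy _]] := approx _ e40; have [_ Ku] := Qu.
(* Almost every [s 0] contains [g], and then [g] fixes [F u s], which is close to [x]. *)
have Wg : W [set s | In (s 0%N) `<=` S /\ In (s 0%N) g].
  have gS : In [:: g] `<=` S by move=> f [<-|].
  apply: filterS (near_coord WE 0%N (USub _ gS)) => s /= [s0S gs0].
  by split => //; apply: gs0; left.
have [s [/= s0S s0g] [/= h1 h2]] := filter_meetP Wg (filterI Fuy (xy _ e40)).
have [_ rfix _] := (rP (s 0%N)).2 s0S.
have KFu : K (F u s) by apply: rK; exact: Ku.
have gFu : g (F u s) = F u s by apply: rfix => //; exact: Ku.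
have [_ gne] := SK _ Sg.
have := gne _ _ Kx KFu; rewrite gFu.
have := ler_distD (F u s) (g x) x; have := ler_distD (y s) (F u s) x.
rewrite [`|y s - x|]distrC [`|x - F u s|]distrC.
by move: h1 h2; clear; lra.
Qed.

(** * Asymptotically nonexpansive semigroups *)

(** The distance to [C] need not be attained, but if it is positive a point within twice the
    distance exists; if it is zero, [x] is in [C] by closedness. *)
Lemma closed_almost_nearest_point (R : realType) (X : normedModType R)
    (C : set X) (x : X) : C !=set0 -> closed C ->
  exists2 c, C c & forall c', C c' -> `|x - c| <= 2 * `|x - c'|.
Proof.
move=> [c0 Cc0] clC; have [Cx|nCx] := pselect (C x).
  by exists x => // c' _; rewrite subrr normr0 mulr_ge0.
pose D := [set d | exists2 c, C c & d = `|x - c|].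
have infD : has_inf D.
  by split; [exists `|x - c0|; exists c0|exists 0 => _ [c _ ->]].
have [e e0 eD] : exists2 e, 0 < e & forall c, C c -> e <= `|x - c|.
  apply: contrapT => /forall2NP h; apply: nCx.
  move/closed_normP : clC; apply => e e0.
  have [//|/existsNP[c /not_implyP[Cc]]] := h e.
  by move/negP; rewrite -ltNge => xc; exists c.
have inf0 : 0 < inf D.
  by apply: (lt_le_trans e0); apply: lb_le_inf => [|_ [c Cc ->]];
    [case: infD|exact: eD].
have [_ [c Cc ->] xc] := inf_adherent inf0 infD.
exists c => // c' Cc'; apply: (le_trans (ltW xc)).
have : inf D <= `|x - c'| by apply: ge_inf; [case: infD|exists c'].
by move: inf0; clear; lra.
Qed.

Section asymptotic_semigroup.
Context (R : realType) (X : completeNormedModType R).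
Hypothesis SX : super_fixed_point_property X.
Context (C : set X) (bodyC : convex_body C).
Context (G : set (X -> X)).
Hypothesis Gid : G id.
Hypothesis Gcomp : forall f g, G f -> G g -> G (f \o g).
Hypothesis GC : forall g, G g -> set_fun C C g.
Hypothesis comG : commuting_on C G.

Definition almost_nonexpansive (e : R) (g : X -> X) :=
  forall x y, C x -> C y -> `|g x - g y| <= `|x - y| + e.

Lemma almost_nonexpansive_comp d e f g : G g ->
  almost_nonexpansive d f -> almost_nonexpansive e g ->
  almost_nonexpansive (d + e) (f \o g).
Proof.
move=> Gg fd ge x y Cx Cy /=.
have := fd _ _ (GC Gg Cx) (GC Gg Cy); have := ge _ _ Cx Cy.
by lra.
Qed.

(** A counterpart of a limsup of displacements for the semigroup [G]: the defect of nonexpansiveness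
    tending to 0 replaces the exponent tending to infinity. *)
Definition asymptotic_displacement_le (x : X) (r : R) :=
  exists2 d, 0 < d & forall g, G g -> almost_nonexpansive d g -> `|g x - x| <= r.

Section ultrapower_of_the_semigroup.
Context (U : set_system nat) (UU : UltraFilter U) (ooU : \oo `<=` U).
Context (Y : completeNormedModType R) (pi : (nat -> X) -> Y).
Hypothesis piU : is_ultrapower U pi.

Definition in_body (u : nat -> X) := forall n, C (u n).

Lemma in_body_bounded u : in_body u -> bounded_map u.
Proof.
have [_ /bounded_set_normP[B CB] _ _] := bodyC.
by move=> Cu; exists B => n; exact: CB.
Qed.

Definition asymptotic (h : nat -> X -> X) := (forall n, G (h n)) /\
  forall e, 0 < e -> U [set n | almost_nonexpansive e (h n)].

Definition ulift (h : nat -> X -> X) (u : nat -> X) n := h n (u n).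

Lemma in_body_ulift h u : asymptotic h -> in_body u -> in_body (ulift h u).
Proof. by move=> [Gh _] Cu n; exact: GC. Qed.

Lemma asymptotic_id : asymptotic (fun=> id).
Proof.
split=> // e e0; apply: (@filterS _ U _ setT) filterT => n _ x y _ _ /=.
by rewrite lerDl ltW.
Qed.

Lemma asymptotic_comp h h' :
  asymptotic h -> asymptotic h' -> asymptotic (fun n => h n \o h' n).
Proof.
move=> [Gh hU] [Gh' hU']; split=> [n|e e0]; first exact: Gcomp.
have e20 : 0 < e / 2 by rewrite divr_gt0.
apply: filterS (filterI (hU _ e20) (hU' _ e20)) => n [h1 h2] /=.
by rewrite [e]splitr; exact: almost_nonexpansive_comp.
Qed.

Lemma norm_pi_le u v c : in_body u -> in_body v ->
  (forall e, 0 < e -> U [set n | `|u n - v n| < c + e]) -> `|pi u - pi v| <= c.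
Proof.
move=> /in_body_bounded bu /in_body_bounded bv h.
by rewrite -(upiB piU)//; apply: (norm_upi_le piU) => //; exact: bounded_mapB.
Qed.

Lemma near_pi_lt u v c : in_body u -> in_body v -> `|pi u - pi v| < c ->
  U [set n | `|u n - v n| < c].
Proof.
move=> /in_body_bounded bu /in_body_bounded bv.
by rewrite -(upiB piU)// => /(near_norm_upi piU); apply; exact: bounded_mapB.
Qed.

Lemma norm_pi_ulift_le h u v : asymptotic h -> in_body u -> in_body v ->
  `|pi (ulift h u) - pi (ulift h v)| <= `|pi u - pi v|.
Proof.
move=> ash Cu Cv; apply: norm_pi_le; try exact: in_body_ulift.
move=> e e0; have e20 : 0 < e / 2 by rewrite divr_gt0.
have uv : U [set n | `|u n - v n| < `|pi u - pi v| + e / 2].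
  by apply: near_pi_lt => //; rewrite ltrDl.
apply: filterS (filterI uv (ash.2 _ e20)) => n [/= h1 h2].
by apply: le_lt_trans (h2 _ _ (Cu n) (Cv n)) _; lra.
Qed.

Lemma ulift_comm h h' u : asymptotic h -> asymptotic h' -> in_body u ->
  ulift h (ulift h' u) = ulift h' (ulift h u).
Proof. by move=> [Gh _] [Gh' _] Cu; apply/funext => n; exact: (comG (Gh n) (Gh' n) (Cu n)). Qed.

Definition ubody : set Y := [set y | exists2 u, in_body u & pi u = y].

(** A representative [v] of a limit point is replaced by almost nearest points [c n] of [C]. The
    distance from [v] to [c] is at most twice that from [v] to any [u] with values in [C], and such
    [u] come arbitrarily close. *)
Lemma ubody_closed : closed ubody.
Proof.
have [C0 _ clC _] := bodyC; apply/closed_normP => y yC.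
have [v bv vy] := upi_surj piU y.
have /choice[c cP] : forall n, exists c, C c /\
    forall c', C c' -> `|v n - c| <= 2 * `|v n - c'|.
  by move=> n; have [c] := closed_almost_nearest_point (v n) C0 clC; exists c.
have Cc : in_body c by move=> n; have [] := cP n.
have bc := in_body_bounded Cc.
exists c => //; apply/eqP; rewrite -subr_eq0 -normr_le0 distrC -vy.
rewrite -(upiB piU)//; apply: (norm_upi_le piU) => [|e e0].
  exact: bounded_mapB.
have e20 : 0 < e / 2 by rewrite divr_gt0.
have [_ [u Cu <-]] := yC _ e20; have bu := in_body_bounded Cu.
rewrite -vy -(upiB piU)// => /(near_norm_upi piU (bounded_mapB bv bu)).
apply: filterS => n /= h; rewrite add0r.
have [_ /(_ (u n) (Cu n))] := cP n.
by move: h; lra.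
Qed.

Context (x : X) (Cx : C x) (r : R) (r0 : 0 < r).
Hypothesis xr : asymptotic_displacement_le x r.

(** Elements [h0 \o h] with [h0] fixed form a tail of the semigroup of asymptotic sequences. Asking
    for closeness only on a tail makes the set invariant: applying [k] turns the tail of [h0] into
    the tail of [k \o h0]. *)
Definition tail_ball : set Y := [set y | ubody y /\ forall e, 0 < e ->
  exists2 h0, asymptotic h0 & forall h, asymptotic h ->
    `|y - pi (ulift h0 (ulift h (fun=> x)))| <= r + e].

Let Cx_ : in_body (fun=> x). Proof. by []. Qed.

Lemma displacement_pi_le h : asymptotic h ->
  `|pi (ulift h (fun=> x)) - pi (fun=> x)| <= r.
Proof.
move=> ash; apply: norm_pi_le => // [|e e0]; first exact: in_body_ulift.
have [d d0 dr] := xr; apply: filterS (ash.2 _ d0) => n /= hd.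
by apply: le_lt_trans (dr _ (ash.1 n) hd) _; rewrite ltrDl.
Qed.

(** The class of [x] belongs to it by the displacement bound. For convexity, commutativity puts the
    tail of the composite [h \o h'] inside both given tails. *)
Lemma tail_ball_body : convex_body tail_ball.
Proof.
have [C0 /bounded_set_normP[B CB] clC /convex_set_combP cC] := bodyC.
split.
- exists (pi (fun=> x)); split; first by exists (fun=> x).
  move=> e e0; exists (fun=> id); first exact: asymptotic_id.
  move=> h /displacement_pi_le xh; rewrite distrC.
  by apply: le_trans xh _; rewrite lerDl ltW.
- apply/bounded_set_normP; exists B => _ [[u Cu <-] _].
  apply: (norm_upi_le piU) => [|e e0]; first exact: in_body_bounded.
  apply: (@filterS _ U _ setT) filterT => n _ /=.
  by apply: le_lt_trans (CB _ (Cu n)) _; rewrite ltrDl.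
- apply/closed_normP => y yK; split.
    move/closed_normP : ubody_closed; apply => e /yK[z [Cz _] yz].
    by exists z.
  move=> e e0; have e20 : 0 < e / 2 by rewrite divr_gt0.
  have [z [_ /(_ _ e20)[h0 ash0 zh]] yz] := yK _ e20.
  exists h0 => // h /zh; set w := pi _ => zw.
  by have := ler_distD z y w; move: yz zw; lra.
- apply/convex_set_combP => _ _ t [[u Cu <-] hu] [[v Cv <-] hv] t0 t1; split.
    exists (fun n => t *: u n + (1 - t) *: v n); first by move=> n; exact: cC.
    have bu := in_body_bounded Cu; have bv := in_body_bounded Cv.
    by rewrite (upiP piU) ?(upiZ piU)//; exact: bounded_mapZ.
  move=> e e0; have [h asH hP] := hu _ e0; have [h' asH' hP'] := hv _ e0.
  exists (fun n => h n \o h' n); first exact: asymptotic_comp.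
  move=> k ask; have h1 := hP _ (asymptotic_comp asH' ask).
  have h2 := hP' _ (asymptotic_comp asH ask).
  have E1 : ulift h (ulift (fun n => h' n \o k n) (fun=> x)) =
    ulift (fun n => h n \o h' n) (ulift k (fun=> x)) by [].
  have E2 : ulift h' (ulift (fun n => h n \o k n) (fun=> x)) =
    ulift (fun n => h n \o h' n) (ulift k (fun=> x)).
    by rewrite -[RHS](@ulift_comm h' h)//; exact: in_body_ulift.
  move: h1 h2; rewrite E1 E2; set w := pi (ulift _ _) => h1 h2.
  rewrite (_ : _ - w = t *: (pi u - w) + (1 - t) *: (pi v - w)); last first.
    rewrite !scalerBr addrACA -opprD -scalerDl.
    by rewrite (_ : t + (1 - t) = 1) ?scale1r//; ring.
  apply: le_trans (ler_normD _ _) _; rewrite !normrZ !ger0_norm ?subr_ge0//.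
  rewrite (_ : r + e = t * (r + e) + (1 - t) * (r + e)); last by ring.
  by apply: lerD; apply: ler_wpM2l; rewrite ?subr_ge0.
Qed.

Lemma tail_ball_fixed : exists u, [/\ in_body u, tail_ball (pi u) &
  forall h, asymptotic h -> pi (ulift h u) = pi u].
Proof.
have SY : super_fixed_point_property Y.
  apply: super_fixed_point_property_representable SX.
  exact: finitely_representable_ultrapower piU.
have /choice[rep repP] : forall y, exists u, ubody y -> in_body u /\ pi u = y.
  move=> y; have [[u Cu uy]|] := pselect (ubody y); last by exists (fun=> x).
  by exists u.
(* By [norm_pi_ulift_le] the value does not depend on the representative chosen in the body; this is
   [hatE]. *)
pose hat h y := pi (ulift h (rep y)).
have hatE h u : asymptotic h -> in_body u -> hat h (pi u) = pi (ulift h u).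
  move=> ash Cu; have uu : ubody (pi u) by exists u.
  have [Crep repu] := repP _ uu.
  apply/eqP; rewrite -subr_eq0 -normr_le0.
  by apply: le_trans (norm_pi_ulift_le ash Crep Cu) _; rewrite repu subrr normr0.
pose S : set (Y -> Y) := [set f | exists2 h, asymptotic h & f = hat h].
have SK f : S f -> nonexpansive_self tail_ball f.
  move=> [h ash ->]; split=> [y [[u Cu <-] uK]|y z [[u Cu <-] _] [[v Cv <-] _]].
    rewrite hatE//; split; first by exists (ulift h u) => //; exact: in_body_ulift.
    move=> e /uK[h0 ash0 h0P]; exists (fun n => h n \o h0 n).
      exact: asymptotic_comp.
    move=> k ask; apply: le_trans (h0P k ask).
    apply: (norm_pi_ulift_le (v := ulift h0 (ulift k (fun=> x))) ash) => //.
    by do 2 apply: in_body_ulift => //.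
  by rewrite !hatE//; exact: norm_pi_ulift_le.
have comS : commuting_on tail_ball S.
  move=> _ _ _ [h ash ->] [h' ash' ->] [[u Cu <-] _].
  rewrite !hatE//; try exact: in_body_ulift.
  by rewrite ulift_comm.
have [_ [[u Cu <-] uK] uF] := commuting_fixed_point SY tail_ball_body SK comS.
exists u; split => //; first by split => //; exists u.
by move=> h ash; rewrite -hatE//; apply: uF; exists h.
Qed.

(** The fixed point [u] is within [r + r / 2] of some point of the orbit, itself within [r] of [x],
    whence [3 * r]. If almost all [u n] had larger displacement than [r / 2], witnesses [h n] of
    defect at most [2^-1 ^+ n] would form an asymptotic sequence that moves the class of [u]. *)
Lemma halve_displacement : exists2 z, C z &
  `|z - x| <= 3 * r /\ asymptotic_displacement_le z (r / 2).
Proof.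
have [u [Cu [_ uK] uF]] := tail_ball_fixed.
have r20 : 0 < r / 2 by rewrite divr_gt0.
have ux : U [set n | `|u n - x| < 3 * r].
  apply: (near_pi_lt (v := fun=> x)) => //.
  have [h0 ash0 /(_ _ asymptotic_id)] := uK _ r20.
  have := displacement_pi_le ash0.
  have -> : ulift h0 (ulift (fun=> id) (fun=> x)) = ulift h0 (fun=> x) by [].
  have := ler_distD (pi (ulift h0 (fun=> x))) (pi u) (pi (fun=> x)).
  by move: r0; lra.
have [ur|nur] := in_ultra_setVsetC
  [set n | asymptotic_displacement_le (u n) (r / 2)] UU.
  have [n /= h1 h2] := filter_meetP ux ur.
  by exists (u n) => //; split => //; exact: ltW.
have h0 n : 0 < 2^-1 ^+ n :> R by rewrite exprn_gt0.
(* At indices with small displacement the default is [id], so that [h] is defined everywhere with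
   the required defect. *)
have /choice[h hP] : forall n, exists g, [/\ G g, almost_nonexpansive (2^-1 ^+ n) g &
    ~ asymptotic_displacement_le (u n) (r / 2) -> r / 2 < `|g (u n) - u n|].
  move=> n; have [a|na] := pselect (asymptotic_displacement_le (u n) (r / 2)).
    by exists id; split => // y z _ _; rewrite lerDl ltW.
  apply: contrapT => /forallNP hg; apply: na; exists (2^-1 ^+ n) => // g Gg gn.
  by rewrite leNgt; apply/negP => gr; apply: (hg g).
have ash : asymptotic h.
  split=> [n|e e0]; first by have [] := hP n.
  have [N hN] := exists_half_expr_lt e0; apply: ooU; exists N => // n /= Nn.
  have [_ hn _] := hP n; move=> y z Cy Cz; apply: le_trans (hn _ _ Cy Cz) _.
  rewrite lerD2l; apply: le_trans (ltW hN).
  by rewrite -(subnKC Nn) exprD ler_piMr ?(ltW (h0 N))// exprn_ile1//; lra.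
have : `|pi (ulift h u) - pi u| < r / 2 by rewrite uF// subrr normr0.
move=> /(near_pi_lt (in_body_ulift ash Cu) Cu) hu.
have [n /= h1 h2] := filter_meetP hu nur.
by have [_ _ /(_ h2)] := hP n; rewrite ltNge (ltW h1).
Qed.

End ultrapower_of_the_semigroup.

(** Repeated halving gives points with displacements [r * 2^-1 ^+ k] and steps of length at most
    [3 * r * 2^-1 ^+ k]; their limit has arbitrarily small asymptotic displacement. *)
Lemma asymptotic_common_fixed_point : exists2 z, C z &
  forall e, 0 < e -> asymptotic_displacement_le z e.
Proof.
have [U [UU ooU]] := ultraFilterLemma (@eventually_filter).
have [Y [pi piU]] := @ultrapower_exists R nat X U UU.
have [[c0 Cc0] /bounded_set_normP[B CB] clC _] := bodyC.
have h0 n : 0 < 2^-1 ^+ n :> R by rewrite exprn_gt0.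
(* Exceeds every displacement inside [C], and is positive even if [B] is 0. *)
pose r : R := 2 * B + 1.
have B0 : 0 <= B by apply: le_trans (CB _ Cc0).
have r0 : 0 < r by rewrite /r; lra.
have c0r : asymptotic_displacement_le c0 (r * 2^-1 ^+ 0).
  exists 1 => // g Gg _; rewrite expr0 mulr1 /r.
  have := ler_normB (g c0) c0; have := CB _ Cc0; have := CB _ (GC Gg Cc0).
  lra.
have /choice[F FP] : forall p : nat * X, exists z,
    C p.2 -> asymptotic_displacement_le p.2 (r * 2^-1 ^+ p.1) ->
    [/\ C z, `|z - p.2| <= 3 * r * 2^-1 ^+ p.1 &
      asymptotic_displacement_le z (r * 2^-1 ^+ p.1.+1)].
  move=> [k x] /=.
  have [[Cx xr]|nx] := pselect (C x /\
      asymptotic_displacement_le x (r * 2^-1 ^+ k)); last first.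
    by exists x => Cx xr; exfalso; apply: nx.
  have rk0 : 0 < r * 2^-1 ^+ k by rewrite mulr_gt0.
  have [z Cz [zx zr]] := halve_displacement UU ooU piU Cx rk0 xr.
  by exists z => _ _; split => //; [rewrite -mulrA|rewrite exprSr mulrA].
pose u := fix u k := if k is l.+1 then F (l, u l) else c0.
have uP k : C (u k) /\ asymptotic_displacement_le (u k) (r * 2^-1 ^+ k).
  by elim: k => [//|k [Cu ur]]; have [] := FP (k, u k) Cu ur.
have [|z hz] := @geometric_cauchy _ X u (3 * r).
  by move=> k; have [Cu ur] := uP k; have [] := FP (k, u k) Cu ur.
have Cz : C z.
  move/closed_normP : clC; apply => e e0.
  have er0 : 0 < e / (6 * r) by rewrite divr_gt0// mulr_gt0.
  have [n] := exists_half_expr_lt er0; rewrite ltr_pdivlMr ?mulr_gt0// => hn.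
  exists (u n); first by have [] := uP n.
  rewrite distrC; apply: le_lt_trans (hz n) _.
  by rewrite (_ : 2 * (3 * r) * _ = 2^-1 ^+ n * (6 * r))//; ring.
exists z => // e e0.
(* The displacement of [z] is at most [(6 + 1 + 6) * r * 2^-1 ^+ n + e / 2], and [26] is twice
   [13]. *)
have er0 : 0 < e / (26 * r) by rewrite divr_gt0// mulr_gt0.
have [n] := exists_half_expr_lt er0; rewrite ltr_pdivlMr ?mulr_gt0// => hn.
have [Cu [d d0 ur]] := uP n.
exists (Num.min d (e / 2)); first by rewrite lt_min d0 divr_gt0.
move=> g Gg gd.
have h1 : `|g (u n) - u n| <= r * 2^-1 ^+ n.
  apply: ur => // y y' Cy Cy'; apply: le_trans (gd _ _ Cy Cy') _.
  by rewrite lerD2l ge_min lexx.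
have h2 : `|g z - g (u n)| <= `|u n - z| + e / 2.
  rewrite [`|u n - z|]distrC; apply: le_trans (gd _ _ Cz Cu) _.
  by rewrite lerD2l ge_min lexx orbT.
have := hz n; have := ler_distD (g (u n)) (g z) z.
have := ler_distD (u n) (g (u n)) z.
move: hn h1 h2; move: (2^-1 ^+ n : R) => p; clear; lra.
Qed.

End asymptotic_semigroup.

(** * The semigroup generated by the family, and its common fixed point *)

Inductive generated_by (R : realType) (X : normedModType R) (I : Type)
    (T : I -> X -> X) : (X -> X) -> Prop :=
  | GeneratedId : generated_by T id
  | GeneratedComp t g : generated_by T g -> generated_by T (T t \o g).

Section generated_by.
Context (R : realType) (X : normedModType R) (C : set X) (I : Type).
Context (T : I -> X -> X).
Hypothesis TC : forall t, set_fun C C (T t).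
Hypothesis comT : forall s t x, C x -> T s (T t x) = T t (T s x).

Lemma generated_comp f g :
  generated_by T f -> generated_by T g -> generated_by T (f \o g).
Proof.
by move=> Tf Tg; elim: Tf => [//|t h _ IH]; exact: (GeneratedComp t IH).
Qed.

Lemma generated_iter t n : generated_by T (iter n (T t)).
Proof.
elim: n => [|n IH]; first exact: GeneratedId.
exact: (GeneratedComp t IH).
Qed.

Lemma generated_set_fun g : generated_by T g -> set_fun C C g.
Proof.
elim=> [x //|t h _ IH x Cx] /=; apply: TC; exact: IH.
Qed.

Lemma generated_comm f g x : generated_by T f -> generated_by T g -> C x ->
  f (g x) = g (f x).
Proof.
move=> Tf; elim: Tf g x => [//|t h Th IH] g x Tg Cx /=.
rewrite IH//; have Chx := generated_set_fun Th Cx.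
elim: Tg => [//|s k Tk IHk] /=.
by rewrite comT ?IHk//; exact: (generated_set_fun Tk).
Qed.

End generated_by.

(** The limsup is an infimum of suprema over sets of [\oo]. As it is below [e], one of these suprema
    is, and its set contains all large [n]. *)
Lemma asymp_nonexpansive_iter (R : realType) (X : completeNormedModType R)
    (C : set X) (f : X -> X) : asymp_nonexpansive_intermediate C f ->
  forall e, 0 < e -> exists N, forall n, (N <= n)%N ->
    almost_nonexpansive C e (iter n f).
Proof.
move=> [_ fsup] e e0.
have /ereal_inf_lt[_ [V [N _ NV] <-] Ve] : (limn_esup (fun n : nat => ereal_sup
    [set (`|iter n f x - iter n f y| - `|x - y|)%:E | x in C & y in C]) < e%:E)%E.
  by apply: le_lt_trans fsup _; rewrite lte_fin.
exists N => n Nn x y Cx Cy; rewrite -lerBlDl -lee_fin.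
apply: le_trans (ltW Ve); apply: le_trans (ereal_sup_ubound _); last first.
  by exists n; [exact: NV|reflexivity].
by apply: ereal_sup_ubound; exists x => //; exists y.
Qed.

Theorem theorem3p3 (R : realType) (X : completeNormedModType R)
    (SFPP : super_fixed_point_property X)
    (C : set X) (C_nonempty : C !=set0) (C_bounded : bounded_set C)
    (C_closed : closed C) (C_convex : convex_set (C : set (convex_lmodType X)))
    (I : Type) (T : I -> X -> X)
    (T_self : forall t : I, set_fun C C (T t))
    (T_commute : forall (s t : I) (x : X), C x -> T s (T t x) = T t (T s x))
    (T_asymp : forall t : I, asymp_nonexpansive_intermediate C (T t)) :
  exists x : X, C x /\ forall t : I, T t x = x.
Proof.
have bodyC : convex_body C by split.
have comG : commuting_on C (generated_by T).
  by move=> f g x Tf Tg Cx; exact: (generated_comm T_self T_commute Tf Tg Cx).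
have [z Cz zT] := asymptotic_common_fixed_point SFPP bodyC (GeneratedId T)
  (@generated_comp R X I T) (generated_set_fun T_self) comG.
exists z; split => // t.
(* The iterates of [T t] belong to the generated semigroup and their defect tends to 0, so
   [iter n (T t) z] tends to [z]. *)
have iter_near e : 0 < e -> exists N, forall n, (N <= n)%N -> `|iter n (T t) z - z| <= e.
  move=> /zT[d d0 hd]; have [N hN] := asymp_nonexpansive_iter (T_asymp t) d0.
  by exists N => n /hN; apply: hd; exact: generated_iter.
have [/subspace_continuousP/(_ z Cz) cT _] := T_asymp t.
apply/eqP; rewrite -subr_eq0 -normr_le0; apply/ler_addgt0Pr => e e0.
have e20 : 0 < e / 2 by rewrite divr_gt0.
move/cvgrPdist_lt : cT => /(_ _ e20).
rewrite near_withinE => /nbhs_ballP[d /= d0 hd].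
(* [d / 2] puts [iter N (T t) z] strictly inside the ball of continuity at [z]; [e / 2] controls its
   image [iter N.+1 (T t) z]. *)
have d20 : 0 < Num.min (d / 2) (e / 2) by rewrite lt_min e20 divr_gt0.
have [N hN] := iter_near _ d20.
have h1 := hN N (leqnn N); have h2 := hN N.+1 (leqnSn N).
have CN : C (iter N (T t) z).
  exact: (generated_set_fun T_self (generated_iter T t N) Cz).
have h3 : `|T t z - T t (iter N (T t) z)| < e / 2.
  apply: hd => //; rewrite -ball_normE /= distrC; apply: le_lt_trans h1 _.
  by rewrite gt_min ltr_pdivrMr// ltr_pMr// ltr1n.
have h4 : `|iter N.+1 (T t) z - z| <= e / 2.
  by apply: le_trans h2 _; rewrite ge_min lexx orbT.
have := ler_distD (T t (iter N (T t) z)) (T t z) z; rewrite add0r.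
by move: h3 h4; rewrite /=; lra.
Qed.
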